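(* Let $G$ be an lcsc group, $U\subset G$ a closed subgroup and $V\triangleleft G$ a closed normal amenable subgroup such that $\psi:U\times V\to G$, $\psi(u,v)=uv$, is a homeomorphism. Let $E_T\subset U$, $F_S\subset V$ be compact sets of positive finite Haar measure (for left Haar measures $m_U$, $m_V$) such that $F_S$ is Følner ($m_V(F_Sv\,\Delta F_S)/m_V(F_S)\to0$ for every $v\in V$) and both families of normalized averages satisfy the strong maximal inequality and the pointwise ergodic theorem in $L^p$, $1<p<\infty$, in every probability-preserving action of $U$ (resp. $V$). Suppose $G$ acts ergodically by measure-preserving transformations on a probability space $(X,m)$, with $\pi(g)f(x)=f(g^{-1}x)$. Then for every $f\in L^p(X)$, $1<p<\infty$, and almost every $x$, $$\lim_{\min(T,S)\to\infty}\frac{1}{m_U(E_T)m_V(F_S)}\int_{E_T}\int_{F_S}\pi(uv)f(x)\,dm_V(v)\,dm_U(u)=\int_X f\,dm,$$ with convergence also in $L^p$-norm. Moreover, the averages on the left coincide with $\frac{1}{m_G(Q_{T,S})}\int_{Q_{T,S}}\pi(g)f(x)\,dm_G(g)$, where $Q_{T,S}=\psi(E_T\times F_S)$ and $m_G=\psi_*(m_U\times m_V)$ is a left Haar measure on $G$. *)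

(* Defs.v *)
From HB Require Import structures.
From mathcomp Require Import all_boot all_order all_algebra.
From mathcomp Require Import all_classical all_reals all_analysis.
Set Implicit Arguments. Unset Strict Implicit. Unset Printing Implicit Defensive.
Import Order.TTheory GRing.Theory Num.Theory.
Import numFieldNormedType.Exports.
Local Open Scope classical_set_scope.
Local Open Scope ring_scope.

(* A (pointed) topological space carrying a group structure (mathcomp's
   [groupType] from boot/monoid.v).  Continuity of the operations is
   imposed separately by [lcsc_group]. *)
HB.structure Definition TopGroup := {G of monoid.Group G & PointedTopological G}.
Notation topGroupType := TopGroup.type.

Definition gmul {G : topGroupType} (x y : G) : G := monoid.mul x y.
Definition ginv {G : topGroupType} (x : G) : G := monoid.inv x.
Definition gone {G : topGroupType} : G := monoid.one.

Definition lcsc_group (G : topGroupType) : Prop :=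
  [/\ continuous (fun p : G * G => gmul p.1 p.2),
      continuous (@ginv G),
      hausdorff_space G,
      locally_compact [set: G] &
      @second_countable G].

Definition Borel (G : topGroupType) := g_sigma_algebraType (@open G).

Definition closed_subgroup {G : topGroupType} (H : set G) : Prop :=
  [/\ closed H, H gone & forall x y, H x -> H y -> H (gmul x (ginv y))].

Definition normal_subgroup {G : topGroupType} (H : set G) : Prop :=
  forall g h, H h -> H (gmul (gmul g h) (ginv g)).

(* A left Haar measure of the closed subgroup H of G, viewed (through the
   closed embedding H -> G) as a Borel measure on G concentrated on H:
   left H-invariant, finite on compact subsets of H and positive on nonempty
   relatively open subsets of H.  (On a lcsc space locally finite Borel
   measures are automatically regular.) *)
Definition left_haar (R : realType) {G : topGroupType} (H : set G)
    (mu : {measure set (Borel G) -> \bar R}) : Prop :=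
  [/\ mu (~` H) = 0%E,
      forall (h : G) (A : set (Borel G)), H h -> measurable A ->
        mu [set gmul h a | a in A] = mu A,
      forall K : set G, compact K -> K `<=` H -> (mu K < +oo)%E &
      forall O : set G, open O -> O `&` H !=set0 -> (0 < mu (O `&` H))%E].

Definition bounded_measurable {G : topGroupType} (R : realType)
    (f : Borel G -> R) : Prop :=
  measurable_fun setT f /\ exists C : R, forall x, `|f x| <= C.

Definition amenable (R : realType) {G : topGroupType} (H : set G)
    (mH : {measure set (Borel G) -> \bar R}) : Prop :=
  exists M : (Borel G -> R) -> R,
  [/\ forall (a : R) (f g : Borel G -> R), bounded_measurable f ->
        bounded_measurable g -> M (fun x => a * f x + g x) = a * M f + M g,
      forall f : Borel G -> R, bounded_measurable f ->
        {ae mH, forall x, H x -> 0 <= f x} -> 0 <= M f,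
      M (fun _ => 1) = 1 &
      forall (h : G) (f : Borel G -> R), H h -> bounded_measurable f ->
        M (fun x : G => f (gmul h x)) = M f].

(* psi : H1 x H2 -> G, (u,v) |-> u v, is a homeomorphism (continuity of psi
   itself follows from continuity of multiplication). *)
Definition product_homeomorphism {G : topGroupType} (H1 H2 : set G) : Prop :=
  (forall u u' v v', H1 u -> H1 u' -> H2 v -> H2 v' ->
     gmul u v = gmul u' v' -> u = u' /\ v = v') /\
  exists p q : G -> G, [/\ continuous p, continuous q &
     forall g, [/\ H1 (p g), H2 (q g) & gmul (p g) (q g) = g]].

Definition mp_action (R : realType) {G : topGroupType} (H : set G)
    {d} {Y : measurableType d} (nu : probability Y R) (a : G -> Y -> Y) : Prop :=
  [/\ forall y, a gone y = y,
      forall g h y, H g -> H h -> a (gmul g h) y = a g (a h y),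
      measurable_fun [set p : Borel G * Y | H p.1] (fun p : Borel G * Y => a p.1 p.2) &
      forall (h : G) (A : set Y), H h -> measurable A -> nu (a h @^-1` A) = nu A].

Definition ergodic_action (R : realType) {G : topGroupType}
    {d} {Y : measurableType d} (nu : probability Y R) (a : G -> Y -> Y) : Prop :=
  mp_action setT nu a /\
  forall A : set Y, measurable A -> (forall g, a g @^-1` A = A) ->
    nu A = 0%E \/ nu A = 1%E.

Definition Lp_fun (R : realType) {d} {Y : measurableType d}
    (nu : {measure set Y -> \bar R}) (p : R) (f : Y -> R) : Prop :=
  measurable_fun setT f /\ (Lnorm nu p%:E (EFin \o f) < +oo)%E.

Definition haar_avg (R : realType) {G : topGroupType}
    (mH : {measure set (Borel G) -> \bar R}) (B : set G)
    {Y : Type} (a : G -> Y -> Y) (f : Y -> R) (y : Y) : R :=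
  (fine (mH B))^-1 * Rintegral mH B (fun h : G => f (a (ginv h) y)).

Definition invariant_cond_exp (R : realType) {G : topGroupType} (H : set G)
    {d} {Y : measurableType d} (nu : probability Y R) (a : G -> Y -> Y)
    (f fs : Y -> R) : Prop :=
  [/\ measurable_fun setT fs,
      forall h y, H h -> fs (a h y) = fs y,
      nu.-integrable setT (EFin \o fs) &
      forall B : set Y, measurable B -> (forall h, H h -> a h @^-1` B = B) ->
        (\int[nu]_(y in B) (fs y)%:E = \int[nu]_(y in B) (f y)%:E)%E].

Definition good_family (R : realType) {G : topGroupType} (H : set G)
    (mH : {measure set (Borel G) -> \bar R}) (B : R -> set G) : Prop :=
  forall d (Y : measurableType d) (nu : probability Y R) (a : G -> Y -> Y),
  mp_action H nu a ->
  forall p : R, 1 < p ->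
  (exists C : R, forall f : Y -> R, Lp_fun nu p f ->
     (Lnorm nu p%:E
        (fun y => ereal_sup [set (`|haar_avg mH (B T) a f y|)%:E | T in [set: R]])
      <= C%:E * Lnorm nu p%:E (EFin \o f))%E) /\
  (forall f : Y -> R, Lp_fun nu p f ->
     exists fs : Y -> R, invariant_cond_exp H nu a f fs /\
       {ae nu, forall y, haar_avg mH (B T) a f y @[T --> +oo] --> fs y}).

Definition folner (R : realType) {G : topGroupType} (H : set G)
    (mH : {measure set (Borel G) -> \bar R}) (B : R -> set G) : Prop :=
  forall h : G, H h ->
    fine (mH (([set gmul x h | x in B S] `\` B S) `|`
              (B S `\` [set gmul x h | x in B S]))) / fine (mH (B S))
      @[S --> +oo] --> (0 : R).

Definition lim_min_inf (R : realType) (u : R -> R -> R) (l : R) : Prop :=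
  forall e : R, 0 < e -> exists N : R, forall T S, N <= T -> N <= S ->
    `|u T S - l| < e.

(* lim_{min(T,S) -> oo} u T S = 0 for nonnegative extended reals u. *)
Definition lim_min_inf0e (R : realType) (u : R -> R -> \bar R) : Prop :=
  forall e : R, 0 < e -> exists N : R, forall T S, N <= T -> N <= S ->
    (u T S < e%:E)%E.

(* Main.v *)
Require Import Defs.
From HB Require Import structures.
From mathcomp Require Import all_boot all_order all_algebra.
From mathcomp Require Import all_classical all_reals all_analysis.
From mathcomp Require Import measurable_realfun.
From mathcomp Require finmap.
Import Order.TTheory GRing.Theory Num.Theory.
Import numFieldNormedType.Exports.
Local Open Scope classical_set_scope.
Local Open Scope ring_scope.

(* Write A_T for the U-averages and B_S for the V-averages, so that the product
   average is A_T (B_S f).  If B_S f converges to f*, the supremum g_N of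
   |B_S f - f*| over S >= N tends to 0 in L^p by dominated convergence, and
   |A_T (B_S f) - A_T f*| is at most the maximal function of g_N, whose L^p norm
   is controlled by that of g_N; hence the difference tends to 0 almost
   everywhere and in L^p, uniformly in T.  The function f* is V-invariant, and
   since V is normal so are the A_T f*; their limit is therefore both U- and
   V-invariant, hence constant by ergodicity.

   The index sets are uncountable and the families E_T, F_S need not depend
   regularly on T, S, so that maximal functions need not be measurable.  Along
   almost every orbit, however, an average depends continuously on the set over
   which it is taken, and the compact subsets of the group are separable for the
   distance m(A \Delta B); every supremum over parameters thus agrees almost
   everywhere with a countable one. *)

(** * Lower integrals and orbits of measure-preserving families *)

(** The integral of a nonnegative function, measurable or not, is a supremum over the simple
    functions below it. The maximal functions in [good_family], suprema over uncountably many
    parameters, are handled in this way. *)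
Lemma le_integral_nonmeasurable (R : realType) d (T : measurableType d)
    (mu : {measure set T -> \bar R}) (f g : T -> \bar R) :
  (forall x, (0 <= f x)%E) -> (forall x, (f x <= g x)%E) ->
  (\int[mu]_x f x <= \int[mu]_x g x)%E.
Proof.
move=> f0 fg; have g0 x : (0 <= g x)%E := le_trans (f0 x) (fg x).
rewrite !ge0_integralTE//; apply: ereal_sup_le => _ [h hf <-].
by exists h => // x; exact: le_trans (hf x) (fg x).
Qed.

(* The smaller function may fail to be measurable: its integral is then a lower integral. *)
Lemma ae_le_integral_nonmeasurable (R : realType) d (T : measurableType d)
    (mu : {measure set T -> \bar R}) (f g : T -> \bar R) :
  (forall x, (0 <= f x)%E) -> (forall x, (0 <= g x)%E) ->
  measurable_fun setT g ->
  {ae mu, forall x, (f x <= g x)%E} ->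
  (\int[mu]_x f x <= \int[mu]_x g x)%E.
Proof.
move=> f0 g0 mg [Z [mZ muZ fgZ]].
(* Raised to +oo on the exceptional null set, [g] dominates [f] everywhere and keeps its
   integral. *)
pose g' x := if x \in Z then +oo%E else g x.
have mg' : measurable_fun setT g'.
  apply: measurable_fun_if => //.
  - by apply: (measurable_fun_bool true); rewrite setTI preimage_mem_true.
  - exact: measurable_funTS.
have -> : (\int[mu]_x g x = \int[mu]_x g' x)%E.
  apply: ge0_ae_eq_integral => //.
    by move=> x _; rewrite /g'; case: ifP.
  exists Z; split => // x /= /not_implyP[_]; apply: contra_notP => xZ.
  by rewrite /g' ifN// notin_setE.
apply: le_integral_nonmeasurable => // x; rewrite /g'; case: ifPn => [_|].
  exact: leey.
by rewrite notin_setE => xZ; apply: contrapT => nfg; apply/xZ/fgZ.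
Qed.

(** With [g] extended by 0 off [K], Tonelli applies to the positive and negative parts separately,
    and the integral is by definition their difference. *)
Lemma measurable_integral_param (R : realType) d1 d2 (T : measurableType d1)
    (Y : measurableType d2) (mu : {sigma_finite_measure set T -> \bar R})
    (K : set T) (g : T * Y -> \bar R) :
  measurable K -> measurable_fun setT g ->
  measurable_fun setT (fun y => \int[mu]_(h in K) g (h, y))%E.
Proof.
move=> mK mg.
have mKY : measurable (K `*` [set: Y]) by exact: measurableX.
pose gK := g \_ (K `*` setT).
have mgK : measurable_fun setT gK.
  by apply/(measurable_restrictT _ _).1 => //; exact: measurable_funTS.
have E y : (\int[mu]_(h in K) g (h, y) =
    \int[mu]_h (gK^\+ (h, y)) - \int[mu]_h (gK^\- (h, y)))%E.
  rewrite integral_mkcond integralE; congr (_ - _)%E; apply: eq_integral => h _;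
    rewrite ?funeposE ?funenegE /gK !patchE in_setX in_setT andbT; by case: ifP.
rewrite (funext E); apply: emeasurable_funB.
- exact: (measurable_fun_fubini_tonelli_G _ (measurable_funepos mgK)).
- exact: (measurable_fun_fubini_tonelli_G _ (measurable_funeneg mgK)).
Qed.

Section measure_preserving_family.
Context {R : realType} {d1 d2} {T : measurableType d1} {Y : measurableType d2}.
Variables (mu : {sigma_finite_measure set T -> \bar R}) (nu : probability Y R).
Variable th : T * Y -> Y.
Hypothesis mth : measurable_fun setT th.
Hypothesis th_nu : forall h A, measurable A -> nu ((fun y => th (h, y)) @^-1` A) = nu A.

(** Tonelli for the preimage of the exceptional set under [th]: its sections at fixed [h] are null
    by invariance, hence so are almost all its sections at fixed [y]. *)
Lemma ae_orbit (P : Y -> Prop) : {ae nu, forall y, P y} ->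
  {ae nu, forall y, {ae mu, forall h, P (th (h, y))}}.
Proof.
move=> [Z [mZ nuZ PZ]].
pose W := th @^-1` Z.
have mW : measurable W by rewrite -[W]setTI; exact: mth.
have := indic_fubini_tonelli mu nu mW.
rewrite indic_fubini_tonelli_FE// indic_fubini_tonelli_GE//.
rewrite [LHS]integral0_eq; last first.
  move=> h _ /=; rewrite -nuZ -[RHS](th_nu h Z mZ); congr (nu _).
  by apply/seteqP; split=> y; rewrite /xsection/= /W inE.
move=> /esym H.
have : ae_eq nu setT (mu \o ysection W) (cst 0%E).
  apply/ae_eq_integral_abs => //; first exact: measurable_fun_ysection.
  by under eq_integral do rewrite /= gee0_abs//.
apply: filterS => y /= /(_ I) W0; exists (ysection W y); split => //.
  exact: measurable_ysection.
move=> h /= nP; rewrite /ysection/= inE /W/=; apply: PZ; exact: nP.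
Qed.

(** Integrating [|phi (th (h, y))|] first in [y] gives [mu K] times the L^1 norm of [phi], by
    invariance. This is finite, so the integral in [h] is finite for almost every [y]. *)
Lemma ae_orbit_integrable (phi : Y -> R) (K : set T) :
  nu.-integrable setT (EFin \o phi) -> measurable K -> (mu K < +oo)%E ->
  {ae nu, forall y, mu.-integrable K (fun h => (phi (th (h, y)))%:E)}.
Proof.
move=> iphi mK muK.
have mphi : measurable_fun setT phi by exact/measurable_EFinP/(measurable_int _ iphi).
pose F (hy : T * Y) := ((\1_K hy.1)%:E * `|phi (th hy)|%:E)%E.
have mphith : measurable_fun setT (phi \o th) by exact: measurableT_comp.
have mF : measurable_fun setT F.
  apply: emeasurable_funM.
    apply/measurable_EFinP.
    exact: measurableT_comp (measurable_indic mK) measurable_fst.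
  by apply/measurable_EFinP; apply: measurableT_comp => //.
have F0 hy : (0 <= F hy)%E by rewrite mule_ge0// lee_fin// indicE.
have := fubini_tonelli F mF F0 (m1 := mu) (m2 := nu).
have mthh h : measurable_fun setT (fun y => th (h, y)).
  by apply: measurableT_comp => //; exact: pair1_measurable.
have normphi h : (\int[nu]_y `|phi (th (h, y))|%:E = \int[nu]_y `|phi y|%:E)%E.
  transitivity (\int[pushforward nu (fun y => th (h, y))]_y `|phi y|%:E)%E.
    rewrite ge0_integral_pushforward//.
    by apply/measurable_EFinP; exact: measurableT_comp.
  by apply: eq_measure_integral => A mA _; exact: th_nu.
rewrite /fubini_F /fubini_G /F/= => tonelli.
pose c : \bar R := (\int[nu]_y `|phi y|%:E)%E.
have cfin : (c < +oo)%E by have /integrableP[] := iphi.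
have fin : (\int[nu]_y \int[mu]_h F (h, y) < +oo)%E.
  rewrite -tonelli (eq_integral (fun h => (\1_K h)%:E * c)%E); last first.
    move=> h _; rewrite ge0_integralZl//.
    - by rewrite normphi.
    - by apply/measurable_EFinP; apply: measurableT_comp => //;
        exact: measurableT_comp.
  rewrite ge0_integralZr//; last 2 first.
    - exact/measurable_EFinP.
    - by apply: integral_ge0.
  rewrite integral_indic// setIT lte_mul_pinfty//; rewrite ?ge0_fin_numE//.
have iG : nu.-integrable setT (fun y => \int[mu]_h F (h, y))%E.
  apply/integrableP; split; first exact: measurable_fun_fubini_tonelli_G.
  under eq_integral do rewrite gee0_abs ?integral_ge0//.
  exact: fin.
have mphithy y : measurable_fun setT (fun h => phi (th (h, y))).
  exact: (measurable_fun_pair1 (f := phi \o th)).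
have := integrable_ae measurableT iG.
apply: filterS => y /(_ I) yfin; apply/integrableP; split.
  exact/measurable_EFinP/measurable_funTS.
move: yfin; rewrite ge0_fin_numE; last by apply: integral_ge0 => h _; exact: F0.
apply: le_lt_trans; rewrite /F/=.
rewrite integral_mkcond; apply: ge0_le_integral => //.
- by move=> h _; rewrite patchE; case: ifP.
- apply/(measurable_restrictT _ _).1 => //; apply: measurableT_comp => //.
  by apply: measurableT_comp => //; exact: measurable_funTS.
- apply: emeasurable_funM; first exact/measurable_EFinP.
  by apply/measurable_EFinP; apply: measurableT_comp.
- move=> h _; rewrite patchE indicE; case: ifP => _; rewrite ?mul1e//.
  by rewrite mule_ge0.
Qed.

End measure_preserving_family.

(** * Second countable groups *)

Section group_identities.
Context {G : topGroupType}.
Implicit Types x y z : G.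

Lemma gmul1l x : gmul gone x = x.
Proof. exact: mul1g. Qed.

Lemma gmul1r x : gmul x gone = x.
Proof. exact: mulg1. Qed.

Lemma gmulA x y z : gmul x (gmul y z) = gmul (gmul x y) z.
Proof. exact: mulgA. Qed.

Lemma gmulVl x : gmul (ginv x) x = gone.
Proof. exact: mulVg. Qed.

Lemma gmulVr x : gmul x (ginv x) = gone.
Proof. exact: mulgV. Qed.

Lemma ginvM x y : ginv (gmul x y) = gmul (ginv y) (ginv x).
Proof. exact: invgM. Qed.

Lemma ginvK x : ginv (ginv x) = x.
Proof. exact: invgK. Qed.

End group_identities.

Lemma second_countable_sequence (T : topologicalType) : @second_countable T ->
  exists b : nat -> set T, (forall n, open (b n)) /\
    forall x A, nbhs x A -> exists n, b n x /\ b n `<=` A.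
Proof.
move=> [B /countable_injP[i iinj] [oB bB]].
(* An index that codes no member of the base yields the empty set, which is open and contains no
   point. *)
pose b n := xget set0 [set W | B W /\ i W = n].
exists b; split=> [n|x A xA].
  rewrite /b; case: xgetP => [W _ [/oB]//|_]; exact: open0.
have [W [BW Wx] WA] := bB x A xA.
have bW : b (i W) = W.
  rewrite /b; case: xgetP => [W' _ [BW' iW']|/(_ W) []//].
  by apply: iinj => //; rewrite inE.
by exists (i W); rewrite bW.
Qed.

Lemma compact_exhaustion (T : ptopologicalType) :
  locally_compact [set: T] -> @second_countable T ->
  exists K : nat -> set T, (forall n, compact (K n) /\ closed (K n)) /\
    forall C, compact C -> exists n, C `<=` K n.
Proof.
move=> lcT /second_countable_sequence[b [ob bb]].
(* [A n] is a closed compact set around [b n] if there is one, and empty otherwise; [D] singles out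
   the indices of the first kind. *)
pose A n := xget set0 [set C | [/\ compact C, closed C & b n `<=` C]].
have cA n : compact (A n) /\ closed (A n).
  rewrite /A; case: xgetP => [C _ []//|_]; split; [exact: compact0|exact: closed0].
pose D := [set n | b n `<=` A n].
have covD : [set: T] `<=` cover D b.
  move=> x _; have [C xC [cC clC]] := lcT x Logic.I.
  have xC' : nbhs x C by move: xC; apply: (@filterS _ (nbhs x)) => y /(_ Logic.I).
  have [n [bnx bnC]] := bb _ _ xC'; exists n => //=.
  rewrite /D/= /A; case: xgetP => [C' _ []//|/(_ C) nC].
  by exfalso; apply: nC; split.
exists (fun n => \big[setU/set0]_(i < n) A i); split=> [n|C].
  split; first by apply: bigsetU_compact => i _; case: (cA i).
  by apply: closed_bigsetU => i _; case: (cA i).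
rewrite compact_cover => /(_ nat D b) []; [by move=> i _|by move=> x _; exact: covD|].
move=> F FD CF; exists (\max_(i <- finmap.enum_fset F) i.+1)%N => x /CF[n /= Fn bnx].
have An : A n x by have /FD := Fn; rewrite inE => /(_ _ bnx).
rewrite -bigcup_mkord; exists n => //=.
by apply: (@leq_bigmax_seq _ _ xpredT (fun i => i.+1)).
Qed.

Section borel.
Context {G : topGroupType}.

Lemma open_Borel (A : set G) : open A -> measurable (A : set (Borel G)).
Proof. exact: sub_sigma_algebra. Qed.

Lemma closed_Borel (A : set G) : closed A -> measurable (A : set (Borel G)).
Proof.
by move=> cA; rewrite -[A]setCK; apply: measurableC; apply: open_Borel; exact: closed_openC.
Qed.

Lemma compact_Borel (A : set G) : hausdorff_space G -> compact A ->
  measurable (A : set (Borel G)).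
Proof. by move=> hG cA; apply: closed_Borel; exact: compact_closed. Qed.

Lemma continuous_Borel (f : G -> G) : continuous f ->
  measurable_fun setT (f : Borel G -> Borel G).
Proof.
move=> cf; apply: (@measurability _ _ (Borel G) (Borel G) setT f (@open G)) => // _ [W oW <-].
by rewrite setTI; apply: open_Borel; move/continuousP: cf; exact.
Qed.

(* Second countability makes the product of the Borel sigma-algebras contain
   the open subsets of G * G. *)
Lemma continuous2_Borel (f : G * G -> G) : @second_countable G -> continuous f ->
  measurable_fun setT (f : Borel G * Borel G -> Borel G).
Proof.
move=> /second_countable_sequence[b [ob bb]] cf.
apply: (@measurability _ _ (Borel G * Borel G)%type (Borel G) setT f (@open G)) =>
  // _ [W oW <-].
rewrite setTI.
pose P i j := b i `*` b j `<=` f @^-1` W.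
have -> : f @^-1` W = \bigcup_i \bigcup_j
    (if `[< P i j >] then b i `*` b j else set0).
  apply/seteqP; split=> [[x y] Wxy|[x y]]; last first.
    by move=> [i _ [j _]]; case: asboolP => // + xy; apply.
  have : nbhs (x, y) (f @^-1` W) by apply: cf; exact: open_nbhs_nbhs.
  move=> [[A B] /= [/bb [i [bix bA]] /bb [j [bjy bB]]] AB].
  exists i => //; exists j => //; case: asboolP => // nP; exfalso; apply: nP.
  by move=> [x' y'] /= [/bA Ax' /bB By']; apply: AB.
apply: bigcupT_measurable => i; apply: bigcupT_measurable => j.
by case: asboolP => // _; apply: measurableX; exact: open_Borel.
Qed.

(* Hence every compact set is an intersection of members of one countable family
   of open sets, the finite unions of members of the base. *)
Lemma compact_bigcap_base (b : nat -> set G) (C : set G) :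
  (forall n, open (b n)) ->
  (forall x A, nbhs x A -> exists n, b n x /\ b n `<=` A) ->
  hausdorff_space G -> compact C ->
  forall x, ~ C x -> exists s : seq nat,
    C `<=` \bigcup_(i in [set` s]) b i /\ ~ (\bigcup_(i in [set` s]) b i) x.
Proof.
move=> ob bb hG cC x nCx.
pose D := [set n | ~ b n x].
have : C `<=` cover D b.
  move=> y Cy; have yx : y != x by apply/eqP => yx; apply: nCx; rewrite -yx.
  have [A [oA yA xA]] : exists A, [/\ open A, y \in A & x \in ~` A].
    exact: (hausdorff_accessible hG).
  have [n [bny bnA]] := bb y A (open_nbhs_nbhs (conj oA (set_mem yA))).
  by exists n => //=; rewrite /D/= => /bnA; exact: (set_mem xA).
move: cC; rewrite compact_cover => /(_ nat D b) /[apply] -[] // F FD CF.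
exists (finmap.enum_fset F); split=> [y /CF//|[n /= Fn]].
by have := FD _ Fn; rewrite inE.
Qed.

End borel.

(** * Reduction of suprema of averages to countable ones *)

(** Absolute continuity of the integral, applied to [psi] extended by 0 off [K]; the bound is
    uniform over the subsets [A]. *)
Lemma Rintegral_small (R : realType) d (T : measurableType d)
    (mu : {measure set T -> \bar R}) (K : set T) (psi : T -> R) :
  measurable K -> mu.-integrable K (EFin \o psi) -> forall e : R, 0 < e ->
  exists2 r : R, 0 < r & forall A, measurable A -> A `<=` K ->
    (mu A < r%:E)%E -> `|Rintegral mu A psi| < e.
Proof.
move=> mK ipsi e e0.
have ipsiK : mu.-integrable setT (EFin \o (psi \_ K)).
  by rewrite -restrict_EFin; apply/(integrable_mkcond _ mK).1.
have [r [r0 rP]] := integral_normr_continuous ipsiK e0.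
exists r => // A mA AK Ar; apply: le_lt_trans (rP _ mA Ar).
have -> : Rintegral mu A psi = Rintegral mu A (psi \_ K).
  apply: eq_Rintegral => x /[!inE] Ax; by rewrite /= /patch mem_set//; exact: AK.
apply: le_normr_Rintegral => //.
exact: integrableS ipsiK.
Qed.

Section countably_many_averages.
Context {R : realType} {G : topGroupType}.
Variables (mu : {measure set (Borel G) -> \bar R}) (K : nat -> set G).
Variables (B : R -> set G) (I : set R).
Hypothesis hG : hausdorff_space G.
Hypothesis scG : @second_countable G.
Hypothesis K_finite : forall n, measurable (K n : set (Borel G)) /\ (mu (K n) < +oo)%E.
Hypothesis K_exhaust : forall C, compact C -> exists n, C `<=` K n.
Hypothesis B_compact : forall S, compact (B S).
Hypothesis B_gt0 : forall S, (0 < mu (B S))%E.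

Let mB S : measurable (B S : set (Borel G)).
Proof. exact: compact_Borel. Qed.

(* Every [B S] is approximated in measure from outside by members of a
   countable family of sets, and one representative [S'] of each member is
   enough because [psi |-> \int_(B S) psi] depends continuously on [B S]. *)
Lemma countably_many_averages : I !=set0 -> exists s : nat -> R,
  (forall k, I (s k)) /\
  forall S, I S -> forall psi : Borel G -> R,
    (forall n, mu.-integrable (K n) (EFin \o psi)) -> forall l c : R,
    (forall k, `|(fine (mu (B (s k))))^-1 * Rintegral mu (B (s k)) psi - l| <= c) ->
    `|(fine (mu (B S)))^-1 * Rintegral mu (B S) psi - l| <= c.
Proof.
move=> [S0 IS0]; have [b [ob bb]] := second_countable_sequence _ scG.
(* Finite intersections of finite unions of base sets form a countable family, coded by
   [seq (seq nat)]; cut down to some [K j] they have finite measure. *)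
pose V (s : seq nat) := \bigcup_(i in [set` s]) b i.
pose W (t : seq (seq nat)) := \big[setI/setT]_(s <- t) V s.
have mV s : measurable (V s : set (Borel G)).
  by apply: bigcup_measurable => i _; exact: open_Borel.
have mW t : measurable (W t : set (Borel G)) by exact: bigsetI_measurable.
pose C j t := K j `&` W t.
have mC j t : measurable (C j t : set (Borel G)).
  by apply: measurableI => //; case: (K_finite j).
pose P (x : nat * nat * seq (seq nat)) S :=
  [/\ I S, B S `<=` C x.1.1 x.2 & (mu (C x.1.1 x.2 `\` B S) < (x.1.2.+1%:R^-1)%:E)%E].
(* Each code [(j, n, t)] receives one parameter whose set fills [C j t] up to measure [1/(n+1)];
   codes without such a parameter receive [S0], which lies in [I]. *)
pose s k := if unpickle k is Some x then xget S0 (P x) else S0.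
exists s; split=> [k|S IS].
  by rewrite /s; case: unpickle => // x; case: xgetP => // S _ [].
have [j BSK] := K_exhaust _ (B_compact S).
have approx n : exists t, P (j, n, t) S.
  (* Among the first [k] codes, keep the finite unions that contain [B S]. By compactness their
     intersections decrease to [B S] inside [K j], so the excess measure tends to 0 by continuity
     from above. *)
  pose tt k := [seq r <- pmap unpickle (iota 0 k) | `[< B S `<=` V r >]].
  have BW k : B S `<=` W (tt k).
    rewrite /W => x Sx; rewrite -bigcap_seq => r /=.
    by rewrite mem_filter => /andP[/asboolP + _]; exact.
  pose D k : set (Borel G) := C j (tt k) `\` B S.
  have D0 : \bigcap_k D k = set0.
    apply/seteqP; split => // x Dx.
    have [_ nSx] := Dx 0%N Logic.I.
    have [r [Sr nrx]] := compact_bigcap_base _ _ ob bb hG (B_compact S) _ nSx.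
    (* The successor is taken because [iota 0 k] only lists the codes below [k]. *)
    have [[_ +] _] := Dx (pickle r).+1 Logic.I.
    rewrite /W -bigcap_seq => /(_ r) /=; rewrite mem_filter => H.
    apply: nrx; apply: H; apply/andP; split; first exact/asboolP.
    rewrite mem_pmap; apply/mapP; exists (pickle r); last by rewrite pickleK.
    by rewrite mem_iota/= add0n.
  have mD k : measurable (D k) by exact: measurableD.
  have : mu \o D @ \oo --> mu (\bigcap_k D k).
    apply: nonincreasing_cvg_mu => //.
    - apply: le_lt_trans (K_finite j).2; rewrite le_measure ?inE//.
        by case: (K_finite j).
      by move=> x [[]].
    - by rewrite D0.
    - move=> k l kl; apply/subsetPset => x [[Kx Wx] nSx]; split => //; split=> //.
      move: Wx; rewrite /W -!bigcap_seq => Wx r /= rk; apply: Wx => /=.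
      move: rk; rewrite /tt -(subnKC kl) iotaD pmap_cat filter_cat mem_cat.
      by move=> ->.
  rewrite D0 measure0 => /fine_cvgP[finD /cvgrPdist_lt /(_ (n.+1%:R^-1))].
  rewrite invr_gt0 ltr0n => /(_ isT) /= small.
  near \oo => k; exists (tt k); split=> /=.
  - exact: IS.
  - by move=> x Sx; split; [exact: BSK|exact: BW].
  - have fk : (mu \o D) k \is a fin_num by near: k.
    have : `|0 - fine (mu (D k))| < n.+1%:R^-1 by near: k.
    rewrite sub0r normrN ger0_norm ?fine_ge0// -lte_fin fineK//.
pose u n := s (pickle (j, n, projT1 (cid (approx n)))).
have uP n : P (j, n, projT1 (cid (approx n))) (u n).
  rewrite /u /s pickleK; case: xgetP => [S' _ //|/(_ S)].
  by case: (cid (approx n)) => t /= + H; move/H.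
have cvg_u psi : (forall n, mu.-integrable (K n) (EFin \o psi)) ->
    Rintegral mu (B (u n)) psi @[n --> \oo] --> Rintegral mu (B S) psi.
  move=> ipsi; apply/cvgrPdist_lt => e e0.
  have e20 : 0 < e / 2 by rewrite divr_gt0.
  have [r r0 rP] := Rintegral_small _ _ _ _ _ _ (K_finite j).1 (ipsi j) _ e20.
  near=> n.
  have nr : n.+1%:R^-1 < r.
    by near: n; apply: (cvgr_lt 0) => //; exact: cvg_harmonic.
  set t := projT1 (cid (approx n)).
  have [_ SC Sn] : P (j, n, t) S by rewrite /t; case: cid.
  have [_ uC un] := uP n; rewrite -/t/= in uC un.
  have CK : C j t `<=` K j by move=> ? [].
  have split_C (A : set (Borel G)) : measurable A -> A `<=` C j t ->
      Rintegral mu (C j t) psi = Rintegral mu A psi + Rintegral mu (C j t `\` A) psi.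
    move=> mA AC; rewrite -Rintegral_setU ?setDUK//.
    - exact: measurableD.
    - by apply: integrableS (ipsi j) => //; exact: (K_finite j).1.
    - by apply/disj_setPS => x [Ax [_]].
  (* Both sets lie in the same [C j t], so their integrals differ only by those over the two small
     excess sets. *)
  have -> : Rintegral mu (B S) psi - Rintegral mu (B (u n)) psi =
      Rintegral mu (C j t `\` B (u n)) psi - Rintegral mu (C j t `\` B S) psi.
    have := split_C _ (mB S) SC; rewrite (split_C _ (mB (u n)) uC) => E.
    by apply/eqP; rewrite subr_eq addrAC eq_sym subr_eq -E addrC.
  rewrite [e]splitr; apply: (le_lt_trans (ler_normB _ _)); apply: ltrD.
  - apply: rP; [exact: measurableD|by move=> x [/CK]|].
    by apply: lt_trans un _; rewrite lte_fin.
  - apply: rP; [exact: measurableD|by move=> x [/CK]|].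
    by apply: lt_trans Sn _; rewrite lte_fin.
have fin_mu S' : (mu (B S') < +oo)%E.
  have [n BK] := K_exhaust _ (B_compact S').
  by apply: le_lt_trans (K_finite n).2; rewrite le_measure ?inE//; exact: (K_finite n).1.
have fine_mu S' : Rintegral mu (B S') (cst 1) = fine (mu (B S')).
  by rewrite Rintegral_cst// mul1r.
move=> psi ipsi l c ucl.
(* The case [psi = 1] shows that the normalizing factors converge as well. *)
have cvg1 : fine (mu (B (u n))) @[n --> \oo] --> fine (mu (B S)).
  rewrite -fine_mu; under eq_fun do rewrite -fine_mu; apply: cvg_u => n.
  have [mK Kfin] := K_finite n.
  apply/integrableP; split; first exact/measurable_EFinP.
  rewrite (eq_integral (cst 1%E)) => [|x _]; last by rewrite /= normr1.
  by rewrite integral_cst//= mul1e.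
have mu0 : fine (mu (B S)) != 0.
  by rewrite gt_eqF// fine_gt0// B_gt0/=; exact: fin_mu.
have cvg2 : `|(fine (mu (B (u n))))^-1 * Rintegral mu (B (u n)) psi - l|
    @[n --> \oo] --> `|(fine (mu (B S)))^-1 * Rintegral mu (B S) psi - l|.
  apply: cvg_norm; apply: cvgB; last exact: cvg_cst.
  by apply: cvgM; [exact: cvgV|exact: cvg_u].
rewrite -(cvg_lim _ cvg2)//; apply: limr_le; first by apply/cvg_ex; eexists; exact: cvg2.
by apply: nearW => n; exact: ucl.
Unshelve. all: by end_near. Qed.

End countably_many_averages.

(** * Moments of order p *)

Section moments.
Context {R : realType} {d} {Y : measurableType d} (nu : probability Y R).
Variable p : R.
Hypothesis p1 : 1 < p.

Let p0 : 0 < p. Proof. exact: lt_trans p1. Qed.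
Let pn0 : p != 0. Proof. by rewrite gt_eqF. Qed.

(** The p-th power of the L^p norm. Being a plain integral, it works directly with dominated
    convergence and with the comparison of nonmeasurable functions. *)
Definition pmoment (f : Y -> R) : \bar R := (\int[nu]_y (`|f y| `^ p)%:E)%E.

Lemma measurable_normpowR (f : Y -> R) : measurable_fun setT f ->
  measurable_fun setT (fun y => (`|f y| `^ p)%:E).
Proof.
move=> mf; apply/measurable_EFinP; apply: (measurableT_comp (measurable_powR p)) => //.
exact: measurableT_comp.
Qed.

Lemma pmoment_ge0 f : (0 <= pmoment f)%E.
Proof. by apply: integral_ge0 => y _; rewrite lee_fin powR_ge0. Qed.

Lemma poweR_Lnorm_EFin (f : Y -> R) : (Lnorm nu p%:E (EFin \o f) `^ p)%E = pmoment f.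
Proof. by rewrite poweR_Lnorm//; apply: eq_integral => y _; rewrite -poweR_EFin. Qed.

Lemma Lp_funP (f : Y -> R) :
  Lp_fun nu p f <-> measurable_fun setT f /\ (pmoment f < +oo)%E.
Proof.
rewrite /Lp_fun -poweR_Lnorm_EFin; split=> -[mf fp]; split => //.
  exact: poweR_lty.
exact: lty_poweRy fp.
Qed.

Lemma ler_normpowR (a b : R) : `|a| <= b -> `|a| `^ p <= `|b| `^ p.
Proof.
move=> ab; apply: (ge0_ler_powR (ltW p0)); rewrite ?nnegrE//.
exact: le_trans ab (ler_norm b).
Qed.

(** On a probability space this follows from [|t| <= 1 + |t|^p]. *)
Lemma Lp_fun_integrable (f : Y -> R) : Lp_fun nu p f -> nu.-integrable setT (EFin \o f).
Proof.
move=> /Lp_funP[mf fp].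
have i1 : nu.-integrable setT (EFin \o (fun=> 1 : R)).
  exact: finite_measure_integrable_cst.
have ip : nu.-integrable setT (fun y => (`|f y| `^ p)%:E).
  apply/integrableP; split; first exact: measurable_normpowR.
  by under eq_integral do rewrite gee0_abs ?lee_fin ?powR_ge0//.
apply: le_integrable (integrableD measurableT i1 ip) => //.
  exact/measurable_EFinP.
move=> y _ /=; rewrite lee_fin [leRHS]ger0_norm ?addr_ge0 ?powR_ge0//.
have [fy1|/ltW fy1] := leP `|f y| 1; first by rewrite ler_wpDr ?powR_ge0.
by rewrite ler_wpDl// le1r_powR// ltW.
Qed.

(** Measurability is asked of the majorant alone, so that [f] may be a product average whose
    measurability is not established. *)
Lemma ae_le_pmoment (f g : Y -> R) : measurable_fun setT g ->
  {ae nu, forall y, `|f y| <= g y} -> (pmoment f <= pmoment g)%E.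
Proof.
move=> mg fg; apply: ae_le_integral_nonmeasurable.
- by move=> y; rewrite lee_fin powR_ge0.
- by move=> y; rewrite lee_fin powR_ge0.
- exact: measurable_normpowR.
- by apply: filterS fg => y fgy; rewrite lee_fin ler_normpowR.
Qed.

Lemma pmomentZ (k : R) (f : Y -> R) : 0 <= k -> measurable_fun setT f ->
  pmoment (fun y => k * f y) = ((k `^ p)%:E * pmoment f)%E.
Proof.
move=> k0 mf; rewrite /pmoment -ge0_integralZl//.
- by apply: eq_integral => y _; rewrite normrM powRM// ger0_norm// EFinM.
- exact: measurable_normpowR.
- by rewrite lee_fin powR_ge0.
Qed.

(** The constant comes from [|f + g| <= 2 max(|f|, |g|)], the p-th power of the maximum being at
    most the sum of the p-th powers. *)
Lemma pmomentD_le (f g : Y -> R) : measurable_fun setT f -> measurable_fun setT g ->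
  (pmoment (fun y => f y + g y)%R <= (2 `^ p)%:E * (pmoment f + pmoment g))%E.
Proof.
move=> mf mg; have mp := measurable_normpowR.
rewrite /pmoment -ge0_integralD//; [|exact: mp|exact: mp].
have mfg : measurable_fun setT (fun y => (`|f y| `^ p)%:E + (`|g y| `^ p)%:E)%E.
  by apply: emeasurable_funD; exact: mp.
rewrite -ge0_integralZl//; last first.
  by move=> y _; rewrite -EFinD lee_fin addr_ge0// powR_ge0.
apply: ge0_le_integral => //.
- by apply: mp; exact: measurable_funD.
- exact: emeasurable_funM.
move=> y _; rewrite -EFinD -EFinM lee_fin mulrDr -!powRM//.
have [fg|/ltW gf] := leP `|f y| `|g y|.
- rewrite ler_wpDl ?powR_ge0//; apply: (ge0_ler_powR (ltW p0)); rewrite ?nnegrE ?mulr_ge0//.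
  by rewrite mulr_natl mulr2n (le_trans (ler_normD _ _))// lerD2r.
- rewrite ler_wpDr ?powR_ge0//; apply: (ge0_ler_powR (ltW p0)); rewrite ?nnegrE ?mulr_ge0//.
  by rewrite mulr_natl mulr2n (le_trans (ler_normD _ _))// lerD2l.
Qed.

(** The infimum over [N] of the p-th powers has an integral below every moment, so it vanishes
    almost everywhere. Only one good index per point and per [e] results, without convergence of the
    whole sequence. *)
Lemma pmoment_cvg0_ae (P : nat -> Y -> R) :
  (forall N, measurable_fun setT (P N)) -> (forall N y, 0 <= P N y) ->
  pmoment (P N) @[N --> \oo] --> 0%E ->
  {ae nu, forall y, forall e, 0 < e -> exists N, P N y < e}.
Proof.
move=> mP P0 cvgP.
pose q y := ereal_inf (range (fun N => (`|P N y| `^ p)%:E)).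
have q0 y : (0 <= q y)%E.
  by apply: le_ereal_inf_tmp => _ [N _ <-]; rewrite lee_fin powR_ge0.
have mq : measurable_fun setT q.
  have := @measurable_fun_einfs _ _ _ setT (fun N y => (`|P N y| `^ p)%:E)
    (fun N => measurable_normpowR _ (mP N)) 0%N.
  congr (measurable_fun _ _); apply/funext => y; congr ereal_inf.
  by apply/seteqP; split=> _ [N _ <-]; exists N.
have qP N : (\int[nu]_y q y <= pmoment (P N))%E.
  apply: ge0_le_integral => //; first exact: measurable_normpowR.
  by move=> y _; apply: ereal_inf_lbound; exists N.
have intq0 : (\int[nu]_y q y = 0)%E.
  apply/eqP; rewrite eq_le integral_ge0// andbT.
  by apply: (cvge_ge _ cvgP); exact: nearW.
have : ae_eq nu setT q (cst 0%E).
  apply/ae_eq_integral_abs => //.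
  by under eq_integral do rewrite gee0_abs//.
apply: filterS => y /(_ Logic.I)/= qy0 e e0.
have : (q y < (e `^ p)%:E)%E by rewrite qy0 lte_fin powR_gt0.
move=> /ereal_inf_lt[_ [N _ <-]]; rewrite lte_fin => PNe; exists N.
rewrite ltNge; apply/negP => eP; move: PNe; rewrite ltNge => /negP; apply.
by apply: (ge0_ler_powR (ltW p0)); rewrite ?nnegrE ?(ltW e0) ?ger0_norm.
Qed.

(** The bound holds for all [S] beyond [N] and all [T] beyond [N'], off one null set. A single good
    pair of indices at a point therefore gives pointwise convergence, and a single index with small
    moments gives the norm bound. *)
Lemma lim_min_inf_of_pmoment (P Q : nat -> Y -> R) (u : R -> R -> Y -> R) (c : R) :
  (forall N, measurable_fun setT (P N)) -> (forall N y, 0 <= P N y) ->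
  (forall N, measurable_fun setT (Q N)) -> (forall N y, 0 <= Q N y) ->
  pmoment (P N) @[N --> \oo] --> 0%E -> pmoment (Q N) @[N --> \oo] --> 0%E ->
  {ae nu, forall y, forall (N N' : nat) (T S : R), N%:R <= S -> N'%:R <= T ->
    `|u T S y - c| <= P N y + Q N' y} ->
  {ae nu, forall y, lim_min_inf (fun T S => u T S y) c} /\
  lim_min_inf0e (fun T S => Lnorm nu p%:E (fun y => (u T S y - c)%:E)).
Proof.
move=> mP P0 mQ Q0 cvgP cvgQ uPQ; split.
  have aP := pmoment_cvg0_ae _ mP P0 cvgP.
  have aQ := pmoment_cvg0_ae _ mQ Q0 cvgQ.
  apply: filterS3 uPQ aP aQ => y uy Py Qy e e0.
  have e20 : 0 < e / 2 by rewrite divr_gt0.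
  have [N PN] := Py _ e20; have [N' QN'] := Qy _ e20.
  exists (Num.max N%:R N'%:R) => T S; rewrite !ge_max => /andP[_ N'T] /andP[NS _].
  by apply: le_lt_trans (uy _ _ _ _ NS N'T) _; rewrite [e]splitr ltrD.
move=> e e0.
have [N HN] : exists N : nat,
    ((2 `^ p)%:E * (pmoment (P N) + pmoment (Q N)) < (e `^ p)%:E)%E.
  have : ((2 `^ p)%:E * (pmoment (P N) + pmoment (Q N)) @[N --> \oo] -->
      (2 `^ p)%:E * (0 + 0))%E.
    apply: cvgeZl; first by [].
    by apply: cvgeD; [|exact: cvgP|exact: cvgQ].
  rewrite adde0 mule0 => /fine_cvgP[fin /cvgr_lt /(_ (e `^ p))].
  rewrite powR_gt0// => /(_ isT) lt_ep.
  have [N _ /(_ N (leqnn N))[finN ltN]] := filterI fin lt_ep.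
  by exists N; rewrite -(fineK finN) lte_fin.
exists N%:R => T S NT NS.
have : (pmoment (fun y => u T S y - c)%R < (e `^ p)%:E)%E.
  apply: le_lt_trans HN; apply: le_trans (pmomentD_le _ _ (mP N) (mQ N)).
  apply: ae_le_pmoment; first exact: measurable_funD.
  by apply: filterS uPQ => y uy; exact: uy.
rewrite -poweR_Lnorm_EFin -poweR_EFin => H; rewrite ltNge; apply/negP => eL.
move: H; rewrite ltNge => /negP; apply; apply: gt0_ler_poweR => //.
- exact: ltW.
- by rewrite in_itv/= leey lee_fin ltW.
- by rewrite in_itv/= leey Lnorm_ge0.
Qed.

End moments.

(** * Averages along orbits of a subgroup *)

Section sigma_finite_measure_of.
Context {R : realType} {d} {T : measurableType d}.
Variables (mu : {measure set T -> \bar R}) (sf : sigma_finite setT mu).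

(** The same measure under a name that records the proof of sigma-finiteness, so that the structure
    required by Fubini's theorem can be attached to it. *)
Definition sigma_finite_measure_of of sigma_finite setT mu : set T -> \bar R := mu.

HB.instance Definition _ := Measure.copy (sigma_finite_measure_of sf) mu.
HB.instance Definition _ :=
  Measure_isSigmaFinite.Build _ _ _ (sigma_finite_measure_of sf) sf.

End sigma_finite_measure_of.

Lemma measurable_ereal_sup (R : realType) d (T : measurableType d) (f : nat -> T -> R) :
  (forall k, measurable_fun setT (f k)) ->
  measurable_fun setT (fun y => ereal_sup (range (fun k => (f k y)%:E))).
Proof.
move=> mf; have := @measurable_fun_esups _ _ _ setT (fun k y => (f k y)%:E)
  (fun k => (measurable_EFinP _ _).2 (mf k)) 0%N.
congr (measurable_fun _ _); apply/funext => y; congr ereal_sup.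
by apply/seteqP; split=> _ [N _ <-]; exists N.
Qed.

Section haar_averages.
Context {R : realType} {G : topGroupType} (H : set G).
Variables (mH : {measure set (Borel G) -> \bar R}) (B : R -> set G).
Hypothesis lcG : lcsc_group G.
Hypothesis sgH : closed_subgroup H.
Hypothesis haarH : left_haar H mH.

(** [left_haar] gives finiteness only on compact subsets of [H]. A compact [K n] splits into its
    trace on the closed set [H], which is compact, and a null part outside [H]. *)
Lemma haar_exhaustion : exists K : nat -> set G,
  (forall n, compact (K n)) /\
  (forall n, measurable (K n : set (Borel G)) /\ (mH (K n) < +oo)%E) /\
  forall C, compact C -> exists n, C `<=` K n.
Proof.
have [_ _ hG lG sG] := lcG; have [clH _ _] := sgH; have [HC0 _ Hfin _] := haarH.
have [K [cK exK]] := compact_exhaustion _ lG sG.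
exists K; split; [by move=> n; case: (cK n)|split => // n]; have [cKn clKn] := cK n.
have mK : measurable (K n : set (Borel G)) by exact: closed_Borel.
have mH' : measurable (H : set (Borel G)) by exact: closed_Borel.
split => //; rewrite -(setIT (K n)) -(setUv H) setIUr measureU; last 3 first.
- exact: measurableI.
- by apply: measurableI => //; exact: measurableC.
- by apply/seteqP; split=> // x [[_ Hx] [_]].
rewrite [X in (_ + X)%E](_ : _ = 0%E); last first.
  apply/eqP; rewrite eq_le measure_ge0 andbT -HC0 le_measure ?inE//.
    by apply: measurableI => //; exact: measurableC.
  exact: measurableC.
rewrite adde0; apply: Hfin; first exact: compact_closedI.
by move=> x [].
Qed.

Lemma haar_sigma_finite : sigma_finite setT mH.
Proof.
have [K [cK [finK exK]]] := haar_exhaustion; exists K => //.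
apply/seteqP; split=> // x _.
by have [n xK] := exK [set x] (@compact_set1 G x); exists n => //; exact: xK.
Qed.

Let smH : {sigma_finite_measure set (Borel G) -> \bar R} :=
  sigma_finite_measure_of mH haar_sigma_finite.

Section action.
Context {d} {Y : measurableType d} (nu : probability Y R) (a : G -> Y -> Y).
Hypothesis actH : mp_action H nu a.

(* Extended by the identity off [H], the orbit map is jointly measurable on the
   whole product and measure preserving for every first coordinate. *)
Definition orbit_map (hy : Borel G * Y) : Y :=
  if hy.1 \in H then a (ginv hy.1) hy.2 else hy.2.

Let mHset : measurable (H : set (Borel G)).
Proof. by have [clH _ _] := sgH; exact: closed_Borel. Qed.

Lemma subgroup_inv h : H h -> H (ginv h).
Proof.
have [_ H1 Hdiv] := sgH => Hh; have := Hdiv _ _ H1 Hh.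
by rewrite /gmul/gone mul1g.
Qed.

Lemma measurable_orbit_map : measurable_fun setT orbit_map.
Proof.
have [_ _ mact _] := actH; have [_ cinv _ _ _] := lcG.
have mHY : measurable [set hy : Borel G * Y | H hy.1].
  have -> : [set hy : Borel G * Y | H hy.1] = H `*` setT.
    by apply/seteqP; split=> -[h y] //= [].
  exact: measurableX.
apply: measurable_fun_if => //.
- apply: (measurable_fun_bool true); rewrite setTI.
  rewrite (_ : _ @^-1` _ = [set hy : Borel G * Y | H hy.1])//.
  by apply/seteqP; split=> hy /= => [/set_mem|/mem_set].
- rewrite setTI.
  apply: (@measurable_comp _ _ _ _ _ _ [set p : Borel G * Y | H p.1]
    (fun p : Borel G * Y => a p.1 p.2) _
    (fun hy : Borel G * Y => (ginv hy.1, hy.2) : Borel G * Y)) => //.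
    by move=> _ [hy /= /set_mem Hhy <-] /=; exact: subgroup_inv.
  apply: measurable_funTS; apply: measurable_fun_pair => //=.
  exact: measurableT_comp (continuous_Borel _ cinv) measurable_fst.
- exact: measurable_funTS measurable_snd.
Qed.

Lemma orbit_map_preserves h A : measurable A ->
  nu ((fun y => orbit_map (h, y)) @^-1` A) = nu A.
Proof.
have [_ _ _ pres] := actH => mA; rewrite /orbit_map/=.
case: (boolP (h \in H)) => // /set_mem Hh; apply: pres => //; exact: subgroup_inv.
Qed.

Lemma ae_orbit_haar (P : Y -> Prop) : {ae nu, forall y, P y} ->
  {ae nu, forall y, {ae mH, forall h, P (orbit_map (h, y))}}.
Proof. exact: (ae_orbit smH nu _ measurable_orbit_map orbit_map_preserves). Qed.

Lemma measurable_orbit_fun (phi : Y -> R) y : measurable_fun setT phi ->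
  measurable_fun setT (fun h : Borel G => phi (orbit_map (h, y))).
Proof.
move=> mphi; apply: (measurable_fun_pair1 (f := phi \o orbit_map)).
exact: measurableT_comp measurable_orbit_map.
Qed.

(** The exhaustion by countably many compact sets provides one null set valid for all [C]. *)
Lemma ae_orbit_loc_integrable (phi : Y -> R) : nu.-integrable setT (EFin \o phi) ->
  {ae nu, forall y, forall C, compact C ->
    mH.-integrable C (fun h => (phi (orbit_map (h, y)))%:E)}.
Proof.
move=> iphi; have [K [cK [finK exK]]] := haar_exhaustion.
have [_ _ hG _ _] := lcG.
have aK : {ae nu, forall y n, mH.-integrable (K n) (fun h => (phi (orbit_map (h, y)))%:E)}.
  apply/ae_foralln => n; have [mK Kfin] := finK n.
  exact: (ae_orbit_integrable smH nu _ measurable_orbit_map orbit_map_preserves).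
apply: filterS aK => y iK C cC; have [n CK] := exK _ cC.
by apply: integrableS (iK n) => //; [exact: (finK n).1|exact: compact_Borel].
Qed.

Hypothesis hB : forall T, [/\ compact (B T), B T `<=` H, (0 < mH (B T))%E &
  (mH (B T) < +oo)%E].

Lemma haar_avgE T (phi : Y -> R) y : haar_avg mH (B T) a phi y =
  (fine (mH (B T)))^-1 * Rintegral mH (B T) (fun h => phi (orbit_map (h, y))).
Proof.
rewrite /haar_avg; congr (_ * _); apply: eq_Rintegral => h /set_mem Bh.
have [_ BH _ _] := hB T.
by rewrite /orbit_map/= mem_set//; exact: BH.
Qed.

Let mB T : measurable (B T : set (Borel G)).
Proof. by have [_ _ hG _ _] := lcG; have [cB _ _ _] := hB T; exact: compact_Borel. Qed.

Lemma measurable_haar_avg T (phi : Y -> R) : measurable_fun setT phi ->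
  measurable_fun setT (haar_avg mH (B T) a phi).
Proof.
move=> mphi.
rewrite (_ : haar_avg mH (B T) a phi = fun y => (fine (mH (B T)))^-1 *
  fine (\int[smH]_(h in B T) (phi (orbit_map (h, y)))%:E)%E); last first.
  by apply/funext => y; rewrite haar_avgE.
apply: measurable_funM => //; apply: measurableT_comp => //.
apply: (measurable_integral_param _ _ _ _ _ smH (B T)
  (fun hy => (phi (orbit_map hy))%:E)) => //.
apply/measurable_EFinP.
exact: measurableT_comp measurable_orbit_map.
Qed.

(** Almost every orbit function is locally integrable, so the reduction to countably many sets
    applies along it. The sequence [s] precedes [phi], and the null set depends neither on [S] nor
    on [l] and [c]; [l] will be 0 for maximal functions and the limit value for errors. *)
Lemma countably_many_haar_averages (I : set R) : I !=set0 -> exists s : nat -> R,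
  (forall k, I (s k)) /\ forall phi, nu.-integrable setT (EFin \o phi) ->
  {ae nu, forall y, forall S l c, I S ->
    (forall k, `|haar_avg mH (B (s k)) a phi y - l| <= c) ->
    `|haar_avg mH (B S) a phi y - l| <= c}.
Proof.
move=> I0; have [K [cK [finK exK]]] := haar_exhaustion; have [_ _ hG _ sG] := lcG.
have [|S|s [Is sP]] := countably_many_averages mH K B I hG sG finK exK _ _ I0.
- by move=> S; have [] := hB S.
- by have [] := hB S.
exists s; split => // phi iphi; have [mphi _] := integrableP _ _ _ iphi.
have := ae_orbit_loc_integrable _ iphi; apply: filterS => y iy S l c IS.
rewrite haar_avgE => sk; apply: sP => //.
- by move=> n; apply: iy.
- by move=> k; have := sk k; rewrite haar_avgE.
Qed.

End action.
End haar_averages.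

(** * Measurable maximal functions and error majorants for good families *)

Section good_families.
Context {R : realType} {G : topGroupType} (H : set G).
Variables (mH : {measure set (Borel G) -> \bar R}) (B : R -> set G).
Hypothesis lcG : lcsc_group G.
Hypothesis sgH : closed_subgroup H.
Hypothesis haarH : left_haar H mH.
Hypothesis hB : forall T, [/\ compact (B T), B T `<=` H, (0 < mH (B T))%E &
  (mH (B T) < +oo)%E].
Hypothesis goodB : good_family H mH B.
Context {d} {Y : measurableType d} (nu : probability Y R) (a : G -> Y -> Y).
Hypothesis actH : mp_action H nu a.
Variable p : R.
Hypothesis p1 : 1 < p.

Let p0 : 0 < p. Proof. exact: lt_trans p1. Qed.
Let pn0 : p != 0. Proof. by rewrite gt_eqF. Qed.

Local Notation avg T phi y := (haar_avg mH (B T) a phi y).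

Let mavg T phi : measurable_fun setT phi -> measurable_fun setT (haar_avg mH (B T) a phi).
Proof. exact: (measurable_haar_avg H mH B lcG sgH haarH nu a actH hB). Qed.

Lemma le_poweR (x y : \bar R) : (0 <= x)%E -> (x <= y)%E -> (x `^ p <= y `^ p)%E.
Proof.
move=> x0 xy; apply: (gt0_ler_poweR (ltW p0)) => //.
- by rewrite in_itv/= x0 leey.
- by rewrite in_itv/= (le_trans x0 xy) leey.
Qed.

(** The supremum over a countable set of parameters is measurable and lies below the full maximal
    function, so the maximal inequality bounds its moment; almost everywhere it still dominates all
    averages. *)
Lemma good_family_maximal : exists C : R, 0 <= C /\
  forall phi, Lp_fun nu p phi -> exists M : Y -> R,
    [/\ measurable_fun setT M, (forall y, 0 <= M y),
        (pmoment nu p M <= C%:E * pmoment nu p phi)%E &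
        {ae nu, forall y, forall T, `|avg T phi y| <= M y}].
Proof.
have [[C0 HC0] _] := goodB _ _ _ _ actH _ p1.
(* The constant of the maximal inequality may be negative, whereas its p-th power is taken below. *)
pose C := Num.max C0 0; have C_ge0 : 0 <= C by rewrite le_max lexx orbT.
exists (C `^ p); split; first exact: powR_ge0.
have [s [_ sP]] := countably_many_haar_averages _ _ _ lcG sgH haarH nu a actH hB
  setT (ex_intro _ 0 Logic.I).
move=> phi Lphi; have [mphi _] := Lphi.
have iphi := Lp_fun_integrable nu p p1 _ Lphi.
pose Me y := ereal_sup (range (fun k => `|avg (s k) phi y|%:E)).
pose fstar y := ereal_sup [set `|avg T phi y|%:E | T in [set: R]].
have mMe : measurable_fun setT Me.
  by apply: measurable_ereal_sup => k; apply: measurableT_comp => //; exact: mavg.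
have Me0 y : (0 <= Me y)%E.
  apply: (@le_trans _ _ `|avg (s 0%N) phi y|%:E); first by rewrite lee_fin.
  by apply: ereal_sup_ubound; exists 0%N.
have Mef y : (Me y <= fstar y)%E.
  by rewrite /Me /fstar; apply: ereal_sup_le => _ [k _ <-]; exists (s k).
have bound : (\int[nu]_y (Me y `^ p) <= (C `^ p)%:E * pmoment nu p phi)%E.
  apply: (@le_trans _ _ (\int[nu]_y (`|fstar y| `^ p))%E).
    apply: le_integral_nonmeasurable => y; first exact: poweR_ge0.
    by apply: le_poweR => //; rewrite (le_trans (Mef y))// lee_abs.
  rewrite -poweR_Lnorm// -poweR_Lnorm_EFin// -poweR_EFin -poweRM; last 2 first.
  - by rewrite lee_fin.
  - exact: Lnorm_ge0.
  apply: le_poweR; first exact: Lnorm_ge0.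
  apply: (le_trans (HC0 _ Lphi)); apply: lee_wpmul2r; first exact: Lnorm_ge0.
  by rewrite lee_fin le_max lexx.
have mMep : measurable_fun setT (fun y => Me y `^ p)%E.
  exact: (measurableT_comp (measurable_poweR p)).
have phifin : (pmoment nu p phi < +oo)%E by have [] := (Lp_funP nu p p1 phi).1 Lphi.
have iMep : nu.-integrable setT (fun y => Me y `^ p)%E.
  apply/integrableP; split => //.
  under eq_integral do rewrite gee0_abs ?poweR_ge0//.
  apply: (le_lt_trans bound).
  by rewrite lte_mul_pinfty// ?lee_fin ?powR_ge0.
(* [fine] sends +oo to 0, which matters only on a null set since [Me] has a finite moment. *)
exists (fine \o Me); split.
- exact: measurableT_comp.
- by move=> y; exact: fine_ge0.
- apply: le_trans bound; apply: ge0_le_integral => //.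
    by apply: measurable_normpowR => //; exact: measurableT_comp.
  move=> y _ /=; case: (Me y) (Me0 y) => [r r0|_|//] /=.
    by rewrite ger0_norm.
  by rewrite (negbTE pn0) leey.
- have fin := integrable_ae measurableT iMep.
  apply: filterS2 fin (sP _ iphi) => y /(_ Logic.I) fy sy T.
  have Mfin : Me y \is a fin_num.
    rewrite ge0_fin_numE//; apply: (lty_poweRy pn0).
    by move: fy; rewrite ge0_fin_numE ?poweR_ge0.
  have := sy T 0 (fine (Me y)) Logic.I; rewrite subr0; apply => k.
  rewrite subr0 -lee_fin fineK//.
  by apply: ereal_sup_ubound; exists k.
Qed.

(** [g N] is a countable supremum of [|avg T phi - fs|] over parameters [T >= N]. It tends to 0
    almost everywhere and is dominated by twice the maximal function, so its moments tend to 0 by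
    dominated convergence. *)
Lemma good_family_limit (phi : Y -> R) : Lp_fun nu p phi ->
  exists (fs : Y -> R) (g : nat -> Y -> R),
  [/\ invariant_cond_exp H nu a phi fs, Lp_fun nu p fs,
      [/\ forall N, Lp_fun nu p (g N), forall N y, 0 <= g N y &
          pmoment nu p (g N) @[N --> \oo] --> 0%E],
      {ae nu, forall y, avg n%:R phi y @[n --> \oo] --> fs y} &
      {ae nu, forall y (N : nat) T, N%:R <= T -> `|avg T phi y - fs y| <= g N y}].
Proof.
move=> Lphi; have [mphi _] := Lphi.
have iphi := Lp_fun_integrable nu p p1 _ Lphi.
have phifin : (pmoment nu p phi < +oo)%E by have [] := (Lp_funP nu p p1 phi).1 Lphi.
have [C [C0 /(_ _ Lphi)[M [mM M0 Mphi aM]]]] := good_family_maximal.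
have [_ /(_ _ Lphi)[fs [fsE acvg]]] := goodB _ _ _ _ actH _ p1.
have Mfin : (pmoment nu p M < +oo)%E.
  by apply: le_lt_trans Mphi _; rewrite lte_mul_pinfty.
have [mfs _ _ _] := fsE.
(* A limit of averages bounded by [M] is bounded by [M]. *)
have afs : {ae nu, forall y, `|fs y| <= M y}.
  apply: filterS2 aM acvg => y My /cvg_norm cy.
  rewrite -(cvg_lim _ cy)//; apply: limr_le; first by apply/cvg_ex; eexists; exact: cy.
  by apply: nearW => T; exact: My.
have Lfs : Lp_fun nu p fs.
  apply/(Lp_funP nu p p1); split; first exact: mfs.
  by apply: le_lt_trans Mfin; exact: ae_le_pmoment.
have /choice[s sP] (N : nat) : exists s : nat -> R, (forall k, N%:R <= s k) /\
  forall phi, nu.-integrable setT (EFin \o phi) ->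
  {ae nu, forall y, forall S l c, N%:R <= S ->
    (forall k, `|avg (s k) phi y - l| <= c) -> `|avg S phi y - l| <= c}.
  by apply: (countably_many_haar_averages _ _ _ lcG sgH haarH nu a actH hB
    [set T | N%:R <= T]); exists N%:R => /=.
pose h N y := ereal_sup (range (fun k => `|avg (s N k) phi y - fs y|%:E)).
have mh N : measurable_fun setT (h N).
  apply: measurable_ereal_sup => k; apply: measurableT_comp => //.
  by apply: measurable_funB => //; exact: mavg.
have h0 N y : (0 <= h N y)%E.
  apply: (@le_trans _ _ `|avg (s N 0%N) phi y - fs y|%:E); first by rewrite lee_fin.
  by apply: ereal_sup_ubound; exists 0%N.
pose g N y := fine (h N y).
have mg N : measurable_fun setT (g N) by exact: measurableT_comp.
have g0 N y : 0 <= g N y by exact: fine_ge0.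
have hM : {ae nu, forall y, forall N, (h N y <= (2 * M y)%:E)%E}.
  apply: filterS2 aM afs => y My fsy N; apply: ge_ereal_sup => _ [k _ <-].
  rewrite lee_fin mulr_natl mulr2n (le_trans (ler_normB _ _))// lerD//.
have hg : {ae nu, forall y, forall N, h N y = (g N y)%:E}.
  apply: filterS hM => y hy N; rewrite fineK// ge0_fin_numE//.
  exact: le_lt_trans (hy N) (ltry _).
have gM : {ae nu, forall y, forall N, g N y <= 2 * M y}.
  by apply: filterS2 hM hg => y hy gy N; rewrite -lee_fin -gy.
have m2M : measurable_fun setT (fun y => 2 * M y) by exact: measurable_funM.
have i2M : nu.-integrable setT (fun y => (`|2 * M y| `^ p)%:E).
  apply/integrableP; split; first exact: measurable_normpowR.
  under eq_integral do rewrite gee0_abs ?lee_fin ?powR_ge0//.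
  rewrite -/(pmoment nu p (fun y => 2 * M y)) pmomentZ//.
  by rewrite lte_mul_pinfty// ?lee_fin ?powR_ge0.
have Lg N : Lp_fun nu p (g N).
  apply/(Lp_funP nu p p1); split; first exact: mg.
  apply: (@le_lt_trans _ _ (pmoment nu p (fun y => 2 * M y))).
    apply: ae_le_pmoment => //.
    by apply: filterS gM => y gy; rewrite ger0_norm.
  have /integrableP[_] := i2M.
  by under eq_integral do rewrite gee0_abs ?lee_fin ?powR_ge0//.
have g_cvg : {ae nu, forall y, g N y @[N --> \oo] --> 0}.
  apply: filterS2 hg acvg => y hy /cvgrPdist_le cy; apply/cvgrPdist_le => e e0.
  have [T0 [_ HT]] := cy e e0.
  near=> N; rewrite sub0r normrN ger0_norm// -lee_fin -hy.
  apply: ge_ereal_sup => _ [k _ <-]; rewrite lee_fin distrC; apply: HT.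
  apply: lt_le_trans ((sP N).1 k).
  by near: N; exact: nbhs_infty_gtr.
exists fs, g; split => //.
- split => //.
  have cvg0 : {ae nu, forall y, [set: Y] y ->
      (`|g N y| `^ p)%:E @[N --> \oo] --> (cst 0%E : Y -> \bar R) y}.
    apply: filterS g_cvg => y gy _ /=.
    apply: cvg_EFin; first exact: nearW.
    rewrite /comp/=; apply/cvgrPdist_lt => e e0.
    (* The p-th root of [e] is the threshold for [g N], whose p-th power must fall below [e]. *)
    have ep : 0 < e `^ p^-1 by rewrite powR_gt0.
    move/cvgrPdist_lt : gy => /(_ _ ep); apply: filterS => N.
    rewrite !sub0r !normrN => gNe; rewrite ger0_norm ?powR_ge0//.
    have <- : (e `^ p^-1) `^ p = e by rewrite -powRrM mulVf// powRr1// ltW.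
    by apply: gt0_ltr_powR => //; rewrite nnegrE// powR_ge0.
  have dom : {ae nu, forall y N, [set: Y] y ->
      (`|(`|g N y| `^ p)%:E| <= (`|2 * M y| `^ p)%:E)%E}.
    apply: filterS gM => y gy N _; rewrite gee0_abs ?lee_fin ?powR_ge0//.
    by apply: ler_normpowR => //; rewrite ger0_norm.
  have [_ _] := dominated_convergence measurableT
    (fun N => measurable_normpowR p _ (mg N)) (measurable_cst 0%E) cvg0 i2M dom.
  by rewrite integral0.
- apply: filterS acvg => y cy; apply: cvg_comp cy.
  exact: cvgr_idn.
- have asP : {ae nu, forall y, forall N, forall S l c, N%:R <= S ->
      (forall k, `|avg (s N k) phi y - l| <= c) -> `|avg S phi y - l| <= c}.
    by apply/ae_foralln => N; exact: (sP N).2.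
  apply: filterS2 asP hg => y sy hy N T NT; apply: sy NT _ => k.
  by rewrite -lee_fin -hy; apply: ereal_sup_ubound; exists k.
Unshelve. all: by end_near. Qed.

End good_families.

(** * Ergodicity *)

Lemma mp_action_subgroup (R : realType) (G : topGroupType) (H : set G)
    d (Y : measurableType d) (nu : probability Y R) (a : G -> Y -> Y) :
  mp_action setT nu a -> mp_action H nu a.
Proof.
move=> [a1 aM ma pa]; split => //.
- by move=> g h y _ _; exact: aM.
- apply: measurable_funS ma => //.
  by move: (@measurableT _ (Borel G * Y)%type); congr measurable; apply/seteqP; split.
- by move=> h A _; exact: pa.
Qed.

(** One of [c - phi] and [phi - c] is nonnegative almost everywhere with integral 0, hence vanishes
    almost everywhere. *)
Lemma ae_eq_mean (R : realType) d (Y : measurableType d) (nu : probability Y R)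
    (phi : Y -> R) (c : R) :
  nu.-integrable setT (EFin \o phi) -> Rintegral nu setT phi = c ->
  {ae nu, forall y, phi y <= c} \/ {ae nu, forall y, c <= phi y} ->
  {ae nu, forall y, phi y = c}.
Proof.
move=> iphi phic; have mphi : measurable_fun setT phi.
  exact/measurable_EFinP/(measurable_int _ iphi).
have ic : nu.-integrable setT (EFin \o (fun=> c)) by exact: finite_measure_integrable_cst.
have Ec : Rintegral nu setT (fun=> c) = c 
  by rewrite Rintegral_cst// [X in fine X](_ : _ = 1%E) ?mulr1//; exact: probability_setT.
have suff0 (psi : Y -> R) : nu.-integrable setT (EFin \o psi) ->
    Rintegral nu setT psi = 0 -> {ae nu, forall y, 0 <= psi y} ->
    {ae nu, forall y, psi y = 0}.
  move=> ipsi psi0 ge0; have mpsi : measurable_fun setT psi.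
    exact/measurable_EFinP/(measurable_int _ ipsi).
  have fin := integrable_fin_num measurableT ipsi.
  have : (\int[nu]_y `|(psi y)%:E| = 0)%E.
    transitivity (\int[nu]_y (psi y)%:E)%E.
      apply: ae_eq_integral => //.
      - by apply/measurable_EFinP; exact: measurableT_comp.
      - exact/measurable_EFinP.
      - by apply: filterS ge0 => y psiy _; rewrite gee0_abs ?lee_fin.
    by rewrite -(fineK fin); congr (_%:E).
  move=> /(ae_eq_integral_abs nu measurableT ((measurable_EFinP _ _).2 mpsi)).
  by apply: filterS => y /(_ Logic.I)[].
move=> [le|ge].
- have : {ae nu, forall y, c - phi y = 0}.
    apply: suff0; first exact: (integrableB measurableT ic iphi).
      by rewrite RintegralB// Ec phic subrr.
    by apply: filterS le => y; rewrite subr_ge0.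
  by apply: filterS => y /eqP; rewrite subr_eq0 => /eqP.
- have : {ae nu, forall y, phi y - c = 0}.
    apply: suff0; first exact: (integrableB measurableT iphi ic).
      by rewrite RintegralB// Ec phic subrr.
    by apply: filterS ge => y; rewrite subr_ge0.
  by apply: filterS => y /eqP; rewrite subr_eq0 => /eqP.
Qed.

Section ergodic_limit.
Context {R : realType} {G : topGroupType} (U V : set G).
Variables (mU : {measure set (Borel G) -> \bar R}) (E : R -> set G).
Hypothesis lcG : lcsc_group G.
Hypothesis sgU : closed_subgroup U.
Hypothesis nV : normal_subgroup V.
Hypothesis haarU : left_haar U mU.
Hypothesis UV : forall g, exists u v, [/\ U u, V v & g = gmul u v].
Hypothesis hE : forall T, [/\ compact (E T), E T `<=` U, (0 < mU (E T))%E &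
  (mU (E T) < +oo)%E].
Context {d} {X : measurableType d} (m : probability X R) (act : G -> X -> X).
Hypothesis erg : ergodic_action m act.

Let actT : mp_action setT m act. Proof. by case: erg. Qed.
Let actU : mp_action U m act. Proof. exact: mp_action_subgroup. Qed.
Let smU : {sigma_finite_measure set (Borel G) -> \bar R} :=
  sigma_finite_measure_of mU (haar_sigma_finite U mU lcG sgU haarU).

Let actM g h x : act (gmul g h) x = act g (act h x).
Proof. by have [_ aM _ _] := actT; exact: aM. Qed.

(** [g v = (g v g^-1) g], and the conjugate lies in [V] by normality. *)
Lemma normal_act_swap (T : Type) (psi : X -> T) :
  (forall v x, V v -> psi (act v x) = psi x) ->
  forall g v x, V v -> psi (act g (act v x)) = psi (act g x).
Proof.
move=> psiV g v x Vv; rewrite -(psiV _ (act g x) (nV g v Vv)) -!actM.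
by rewrite -gmulA gmulVl gmul1r.
Qed.

Lemma invariant_preimage (A : set X) :
  (forall u x, U u -> A (act u x) = A x) -> (forall v x, V v -> A (act v x) = A x) ->
  forall g, act g @^-1` A = A.
Proof.
move=> AU AV g; have [u [v [Uu Vv ->]]] := UV g.
by apply/funext => x; rewrite /preimage /mkset actM AU// AV.
Qed.

(* [L], the upper limit of the averages of a [V]-invariant function, is strictly
   [V]-invariant; averaging the condition [c < L] over [U]-orbits makes it
   strictly [U]-invariant too, as ergodicity requires. *)
Lemma ergodic_limit (fs fss : X -> R) :
  measurable_fun setT fs -> (forall v x, V v -> fs (act v x) = fs x) ->
  m.-integrable setT (EFin \o fss) -> (forall u x, U u -> fss (act u x) = fss x) ->
  {ae m, forall x, haar_avg mU (E n%:R) act fs x @[n --> \oo] --> fss x} ->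
  {ae m, forall x, fss x = Rintegral m setT fss}.
Proof.
move=> mfs fsV ifss fssU cvg; pose c := Rintegral m setT fss.
have [clU U1 _] := sgU; have [mUC Uinv _ _] := haarU.
have mfss : measurable_fun setT fss by exact/measurable_EFinP/(measurable_int _ ifss).
have mUset : measurable (U : set (Borel G)) by exact: closed_Borel.
(* [L] is defined at every point and inherits strict [V]-invariance from the averages, whereas [fss]
   is their limit only almost everywhere. *)
pose L x := limn_esup (fun n => (haar_avg mU (E n%:R) act fs x)%:E).
have mL : measurable_fun setT L.
  apply: measurable_fun_limn_esup => n; apply/measurable_EFinP.
  exact: (measurable_haar_avg U mU E lcG sgU haarU m act actU hE).
have LV v x : V v -> L (act v x) = L x.
  move=> Vv; congr limn_esup; apply/funext => n; congr (_%:E).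
  rewrite /haar_avg; congr (_ * _); apply: eq_Rintegral => u _.
  exact: normal_act_swap.
pose D := [set x | (c%:E < L x)%E].
have mD : measurable D.
  have := emeasurable_fun_o_infty measurableT mL c%:E.
  by rewrite setTI.
have DV v x : V v -> D (act v x) = D x by move=> Vv; rewrite /D/= LV.
have aD : {ae m, forall x, D x <-> c < fss x}.
  apply: filterS cvg => x cx; rewrite /D/= /L.
  have cx' : (haar_avg mU (E n%:R) act fs x)%:E @[n --> \oo] --> (fss x)%:E.
    by apply: cvg_EFin => //; exact: nearW.
  by rewrite (cvg_limn_einf_sup cx').2 lte_fin.
(* [W x] holds the [u] whose translate [u^-1 x] misses [D]. The set [Ds] below, where [W x] is null,
   is the strictly invariant version of [D]. *)
pose W x : set (Borel G) := [set u | U u /\ ~ D (act (ginv u) x)].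
have WE x : W x = U `&` ysection (orbit_map U act @^-1` (~` D)) x.
  apply/seteqP; split=> u [Uu nD]; split => //; move: nD;
    by rewrite /ysection/= inE/= /orbit_map/= mem_set.
have mpre : measurable (orbit_map U act @^-1` (~` D)).
  rewrite -[X in measurable X]setTI.
  apply: (measurable_orbit_map U lcG sgU m act actU) => //.
  exact: measurableC.
have mW x : measurable (W x).
  by rewrite WE; apply: measurableI => //; exact: measurable_ysection.
pose Ds := [set x | mU (W x) = 0%E].
have mDs : measurable Ds.
  have mmW : measurable_fun setT (fun x => mU (W x)).
    rewrite (_ : (fun x => mU (W x)) =
        smU \o ysection (orbit_map U act @^-1` (~` D) `&` (U `*` setT))).
      apply: measurable_fun_ysection; apply: measurableI => //.
      exact: measurableX.
    apply/funext => x /=; rewrite WE; congr (mU _).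
    apply/seteqP; split=> u; rewrite /ysection/=.
      by move=> [Uu /set_mem nD]; apply/mem_set.
    by move=> /set_mem[nD [Uu _]]; split => //; exact/mem_set.
  rewrite (_ : Ds = setT `&` (fun x => mU (W x)) @^-1` [set 0%E]); last by rewrite setTI.
  by apply: mmW => //; exact: emeasurable_set1.
(* Moving [x] by [u] translates [W x] on the left, which preserves its Haar measure. *)
have WU u x : U u -> W (act u x) = [set gmul u h | h in W x].
  move=> Uu; have [_ _ Udiv] := sgU.
  apply/seteqP; split=> [h [Uh nD]|_ [h [Uh nD] <-]].
  - exists (gmul (ginv u) h); last by rewrite gmulA gmulVr gmul1l.
    split; last by rewrite ginvM ginvK actM.
    have := Udiv _ _ (subgroup_inv _ sgU _ Uu) (subgroup_inv _ sgU _ Uh).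
    by rewrite ginvK.
  - split; last by rewrite ginvM -actM -gmulA gmulVl gmul1r.
    by have := Udiv _ _ Uu (subgroup_inv _ sgU _ Uh); rewrite ginvK.
have WV v x : V v -> W (act v x) = W x.
  move=> Vv; apply/funext => u.
  have E' := normal_act_swap _ D DV (ginv u) v x Vv.
  by rewrite /W /mkset E'.
have DsU u x : U u -> Ds (act u x) = Ds x.
  move=> Uu; rewrite /Ds /mkset (WU u x Uu).
  by congr (_ = _); exact: (Uinv u (W x) Uu (mW x)).
have DsV v x : V v -> Ds (act v x) = Ds x.
  by move=> Vv; rewrite /Ds /mkset (WV v x Vv).
have Dsinv := invariant_preimage Ds DsU DsV.
have U_gt0 : (0 < mU U)%E.
  have [cE EU E0 _] := hE 0; apply: (lt_le_trans E0).
  by rewrite le_measure ?inE//; apply: compact_Borel => //; case: lcG.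
(* Since [fss] is constant on [U]-orbits, for almost every [x] the set [W x] is null if [c < fss x]
   and conull in [U] otherwise; [mU U > 0] separates the two cases. *)
have aDs : {ae m, forall x, Ds x <-> c < fss x}.
  have := ae_orbit_haar U mU lcG sgU haarU m act actU _ aD.
  apply: filterS => x ax.
  have fss_orbit u : fss (orbit_map U act (u, x)) = fss x.
    rewrite /orbit_map/=; case: ifPn => // /set_mem Uu.
    by rewrite fssU//; exact: subgroup_inv.
  have orbE u : U u -> orbit_map U act (u, x) = act (ginv u) x.
    by move=> Uu; rewrite /orbit_map/= mem_set.
  split=> [Dsx|cx].
    apply: contrapT => ncx.
    suff : mU U = 0%E by move=> U0; move: U_gt0; rewrite U0 ltxx.
    apply: measure_negligible => //.
    have W0 : mU.-negligible (W x) by exists (W x); split.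
    apply: negligibleS (negligibleU ax W0) => u Uu /=.
    have [Du|nDu] := pselect (D (act (ginv u) x)); last by right.
    by left => /=; rewrite fss_orbit orbE// => -[/(_ Du)].
  rewrite /Ds/=; apply: measure_negligible => //.
  apply: negligibleS ax => u [Uu nD] /=.
  by rewrite fss_orbit orbE// => -[_ /(_ cx)].
(* By ergodicity [Ds] has measure 0 or 1, so [fss] lies almost everywhere on one side of its
   mean. *)
apply: (ae_eq_mean _ _ _ _ _ _ ifss erefl).
have [_ /(_ Ds mDs Dsinv)[Ds0|Ds1]] := erg.
- left; have aDs0 : {ae m, forall x, ~ Ds x}.
    by exists Ds; split => // x /= /contrapT.
  apply: filterS2 aDs aDs0 => x Dsx nDsx.
  by rewrite leNgt; apply/negP => /Dsx.
- right; have aDs1 : {ae m, forall x, Ds x}.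
    exists (~` Ds); split => //; first exact: measurableC.
    by rewrite probability_setC// Ds1 subee.
  by apply: filterS2 aDs aDs1 => x Dsx /Dsx /ltW.
Qed.

End ergodic_limit.

(** * Convergence of the product averages *)

Lemma aeI (R : realType) d (T : measurableType d) (mu : {measure set T -> \bar R})
    (P Q : T -> Prop) : {ae mu, forall x, P x} -> {ae mu, forall x, Q x} ->
  {ae mu, forall x, P x /\ Q x}.
Proof. by apply: filterS2. Qed.

(** Integrability of [F1] is part of the conclusion: [F1 - F2] is dominated by [F3], and [F2] is
    added back. *)
Lemma Rintegral_dist_le (R : realType) d (T : measurableType d)
    (mu : {measure set T -> \bar R}) (K : set T) (F1 F2 F3 : T -> R) :
  measurable K -> measurable_fun K F1 -> mu.-integrable K (EFin \o F2) ->
  mu.-integrable K (EFin \o F3) -> (forall h, 0 <= F3 h) ->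
  {ae mu, forall h, K h -> `|F1 h - F2 h| <= F3 h} ->
  mu.-integrable K (EFin \o F1) /\
  `|Rintegral mu K F1 - Rintegral mu K F2| <= Rintegral mu K F3.
Proof.
move=> mK mF1 iF2 iF3 F30 F123.
have mF2 : measurable_fun K F2 by exact/measurable_EFinP/(measurable_int _ iF2).
have mF3 : measurable_fun K F3 by exact/measurable_EFinP/(measurable_int _ iF3).
have mF12 : measurable_fun K (fun h => F1 h - F2 h) by exact: measurable_funB.
have le12 : (\int[mu]_(h in K) `|(F1 h - F2 h)%:E| <= \int[mu]_(h in K) (F3 h)%:E)%E.
  apply: ae_ge0_le_integral => //.
  - by apply/measurable_EFinP; exact: measurableT_comp.
  - by move=> h _; rewrite lee_fin.
  - exact/measurable_EFinP.
have i12 : mu.-integrable K (EFin \o (fun h => F1 h - F2 h)).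
  apply/integrableP; split; first exact/measurable_EFinP.
  apply: (le_lt_trans le12).
  by have := integrable_fin_num mK iF3; rewrite fin_numElt => /andP[].
have iF1 : mu.-integrable K (EFin \o F1).
  have := integrableD mK i12 iF2; apply: eq_integrable => // h _ /=.
  by rewrite -EFinD subrK.
split=> //; rewrite -RintegralB//.
apply: (le_trans (le_normr_Rintegral mK i12)).
rewrite /Rintegral fine_le//.
- apply: (integrable_fin_num mK); exact: (integrable_norm i12).
- exact: (integrable_fin_num mK iF3).
Qed.

Section product_averages.
Context {R : realType} {G : topGroupType} (U V : set G).
Variables (mU mV : {measure set (Borel G) -> \bar R}) (E F : R -> set G).
Hypothesis lcG : lcsc_group G.
Hypothesis sgU : closed_subgroup U.
Hypothesis sgV : closed_subgroup V.
Hypothesis nV : normal_subgroup V.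
Hypothesis haarU : left_haar U mU.
Hypothesis haarV : left_haar V mV.
Hypothesis UV : forall g, exists u v, [/\ U u, V v & g = gmul u v].
Hypothesis hE : forall T, [/\ compact (E T), E T `<=` U, (0 < mU (E T))%E &
  (mU (E T) < +oo)%E].
Hypothesis hF : forall S, [/\ compact (F S), F S `<=` V, (0 < mV (F S))%E &
  (mV (F S) < +oo)%E].
Hypothesis goodE : good_family U mU E.
Hypothesis goodF : good_family V mV F.
Context {d} {X : measurableType d} (m : probability X R) (act : G -> X -> X).
Hypothesis erg : ergodic_action m act.
Variables (p : R) (f : X -> R).
Hypothesis p1 : 1 < p.
Hypothesis Lf : Lp_fun m p f.

Let actT : mp_action setT m act. Proof. by case: erg. Qed.
Let actU : mp_action U m act. Proof. exact: mp_action_subgroup. Qed.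
Let actV : mp_action V m act. Proof. exact: mp_action_subgroup. Qed.

Let hG : hausdorff_space G. Proof. by case: lcG. Qed.
Let mE T : measurable (E T : set (Borel G)).
Proof. by have [cE _ _ _] := hE T; exact: compact_Borel. Qed.

Definition product_avg T S x := (fine (mU (E T)) * fine (mV (F S)))^-1 *
  Rintegral mU (E T) (fun u : G =>
    Rintegral mV (F S) (fun v : G => f (act (ginv (gmul u v)) x))).

(** As [(uv)^-1 = v^-1 u^-1], the inner integral is the [V]-average of [f] at [u^-1 x], up to
    normalization. *)
Lemma product_avgE T S x :
  mU.-integrable (E T) (fun u => (haar_avg mV (F S) act f (orbit_map U act (u, x)))%:E) ->
  product_avg T S x = (fine (mU (E T)))^-1 *
    Rintegral mU (E T) (fun u => haar_avg mV (F S) act f (orbit_map U act (u, x))).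
Proof.
move=> iA; have [_ EU _ _] := hE T; have [_ _ F0 Ffin] := hF S.
have FS0 : fine (mV (F S)) != 0 by rewrite gt_eqF// fine_gt0// F0.
rewrite /product_avg invfM -mulrA; congr (_ * _).
rewrite (_ : Rintegral _ _ _ = Rintegral mU (E T) (fun u => fine (mV (F S)) *
    haar_avg mV (F S) act f (orbit_map U act (u, x)))); last first.
  apply: eq_Rintegral => u /set_mem Eu; rewrite /haar_avg mulVKf//.
  have Uu := EU _ Eu; apply: eq_Rintegral => v _.
  rewrite /orbit_map/= mem_set//; have [_ aM _ _] := actT.
  by rewrite ginvM aM.
by rewrite RintegralZl// mulKf.
Qed.

Lemma product_avg_cvg :
  {ae m, forall x, lim_min_inf (fun T S => product_avg T S x) (Rintegral m setT f)} /\
  lim_min_inf0e (fun T S =>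
    Lnorm m p%:E (fun x => (product_avg T S x - Rintegral m setT f)%:E)).
Proof.
have [mf _] := Lf; have if_ := Lp_fun_integrable m p p1 _ Lf.
(* [fs] is the limit of the [V]-averages of [f], and [fss] that of the [U]-averages of [fs]; [g] and
   [g'] majorize the respective errors. *)
have [fs [g [[mfs fsV ifs fsE] Lfs [Lg g0 gcvg] _ Vbound]]] :=
  good_family_limit V mV F lcG sgV haarV hF goodF m act actV p p1 f Lf.
have [fss [g' [[mfss fssU ifss fssE] Lfss [Lg' g'0 g'cvg] Ucvg Ubound]]] :=
  good_family_limit U mU E lcG sgU haarU hE goodE m act actU p p1 fs Lfs.
have [C [C0 HC]] :=
  good_family_maximal U mU E lcG sgU haarU hE goodE m act actU p p1.
have /choice[M HM] (N : nat) : exists M : X -> R,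
    [/\ measurable_fun setT M, (forall y, 0 <= M y),
        (pmoment m p M <= C%:E * pmoment m p (g N))%E &
        {ae m, forall y, forall T, `|haar_avg mU (E T) act (g N) y| <= M y}].
  exact: HC.
(* Conditional expectations preserve the integral over the whole space, an invariant set. *)
have mean_fss : Rintegral m setT fss = Rintegral m setT f.
  rewrite /Rintegral; congr fine.
  rewrite (fssE setT measurableT (fun u _ => preimage_setT (act u))).
  exact: (fsE setT measurableT (fun v _ => preimage_setT (act v))).
have fss_const := ergodic_limit U V mU E lcG sgU nV haarU UV hE m act erg fs fss
  mfs (fun v x => fsV v x) ifss (fun u x => fssU u x) Ucvg.
rewrite mean_fss in fss_const.
have ig N := Lp_fun_integrable m p p1 _ (Lg N).
have mg N : measurable_fun setT (g N) by case: (Lg N).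
have aM : {ae m, forall x N T, `|haar_avg mU (E T) act (g N) x| <= M N x}.
  by apply/ae_foralln => N; case: (HM N).
have loc_g : {ae m, forall x N C, compact C ->
    mU.-integrable C (fun h => (g N (orbit_map U act (h, x)))%:E)}.
  apply/ae_foralln => N.
  exact: (ae_orbit_loc_integrable U mU lcG sgU haarU m act actU _ (ig N)).
have loc_fs := ae_orbit_loc_integrable U mU lcG sgU haarU m act actU _ ifs.
(* The error bound for the [V]-averages is needed at [u^-1 x]: it holds for almost every [u] along
   almost every orbit. *)
have Vorbit := ae_orbit_haar U mU lcG sgU haarU m act actU _ Vbound.
have main : {ae m, forall x, forall (N N' : nat) (T S : R), N%:R <= S -> N'%:R <= T ->
    `|product_avg T S x - Rintegral m setT f| <= M N x + g' N' x}.
  apply: filterS (aeI _ _ _ _ _ _ (aeI _ _ _ _ _ _ aM loc_g)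
    (aeI _ _ _ _ _ _ (aeI _ _ _ _ _ _ loc_fs Vorbit)
      (aeI _ _ _ _ _ _ Ubound fss_const))) => x [[Mx gx] [[fsx Vx] [Ux fssx]]] N N' T S NS N'T.
  have [cE EU E0 Efin] := hE T.
  have mA : measurable_fun (E T : set (Borel G))
      (fun u => haar_avg mV (F S) act f (orbit_map U act (u, x))).
    apply: measurable_funTS.
    apply: (measurable_orbit_fun U lcG sgU m act actU).
    exact: (measurable_haar_avg V mV F lcG sgV haarV m act actV hF).
  have [iA dA] := Rintegral_dist_le _ _ _ mU (E T) _
    (fun u => fs (orbit_map U act (u, x))) (fun u => g N (orbit_map U act (u, x)))
    (mE T) mA (fsx _ cE) (gx N _ cE) (fun h => g0 N _)
    (filterS (fun u Vu _ => Vu N S NS) Vx).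
  rewrite product_avgE// -fssx.
  (* The [U]-average of [fs] is inserted: the first difference is at most the [U]-average of [g N],
     hence at most [M N x], and the second at most [g' N' x]. *)
  rewrite -(subrK (haar_avg mU (E T) act fs x) (_ * _)) -addrA.
  apply: (le_trans (ler_normD _ _)); apply: lerD; last exact: Ux.
  apply: le_trans (Mx N T).
  rewrite !(haar_avgE U mU E act hE) -mulrBr !normrM; apply: ler_wpM2l => //.
  exact: le_trans dA (ler_norm _).
have cvgM : pmoment m p (M N) @[N --> \oo] --> 0%E.
  apply: (@squeeze_cvge _ _ _ _ (cst 0%E) _ (fun N => C%:E * pmoment m p (g N))%E).
  - by apply: nearW => N; rewrite pmoment_ge0/=; case: (HM N).
  - exact: cvg_cst.
  - by rewrite -(mule0 C%:E); apply: cvgeZl; [|exact: gcvg].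
apply: (lim_min_inf_of_pmoment m p p1 M g' product_avg _ _ _ _ _ cvgM g'cvg main) => //.
- by move=> N; case: (HM N).
- by move=> N; case: (HM N).
- by move=> N; case: (Lg' N).
Qed.

End product_averages.

(** * The product Haar measure *)

Lemma haar_translate (R : realType) (G : topGroupType) (H : set G)
    (mH : {measure set (Borel G) -> \bar R}) (h : G) (phi : Borel G -> \bar R) :
  lcsc_group G -> left_haar H mH -> H h -> measurable_fun setT phi ->
  (forall x, (0 <= phi x)%E) ->
  (\int[mH]_x phi (gmul h x) = \int[mH]_x phi x)%E.
Proof.
move=> lcG [_ inv _ _] Hh mphi phi0; have [cmul _ _ _ sG] := lcG.
have mh : measurable_fun setT (gmul h : Borel G -> Borel G).
  apply: (measurable_fun_pair2 (f := fun p : Borel G * Borel G => gmul p.1 p.2 : Borel G)).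
  exact: (continuous2_Borel _ sG cmul).
transitivity (\int[pushforward mH (gmul h : Borel G -> Borel G)]_x phi x)%E.
  by rewrite [RHS]ge0_integral_pushforward.
apply: eq_measure_integral => A mA _; rewrite /pushforward.
have mA' : measurable ((gmul h : Borel G -> Borel G) @^-1` A).
  by rewrite -[X in measurable X]setTI; exact: mh.
apply: (etrans (esym (inv h _ Hh mA'))); congr (mH _); apply/seteqP; split=> [_ [x Ax <-]//|x Ax].
exists (gmul (ginv h) x); last by rewrite gmulA gmulVr gmul1l.
by rewrite /preimage/= gmulA gmulVr gmul1l.
Qed.

Section product_haar.
Context {R : realType} {G : topGroupType} (U V : set G).
Variables (mU mV : {measure set (Borel G) -> \bar R}).
Hypothesis lcG : lcsc_group G.
Hypothesis sgU : closed_subgroup U.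
Hypothesis sgV : closed_subgroup V.
Hypothesis nV : normal_subgroup V.
Hypothesis haarU : left_haar U mU.
Hypothesis haarV : left_haar V mV.
Hypothesis psi_homeo : product_homeomorphism U V.

Let smU : {sigma_finite_measure set (Borel G) -> \bar R} :=
  sigma_finite_measure_of mU (haar_sigma_finite U mU lcG sgU haarU).
Let smV : {sigma_finite_measure set (Borel G) -> \bar R} :=
  sigma_finite_measure_of mV (haar_sigma_finite V mV lcG sgV haarV).

Let hG : hausdorff_space G. Proof. by case: lcG. Qed.

Definition mulBorel (uv : Borel G * Borel G) : Borel G := gmul uv.1 uv.2.

Lemma measurable_mulBorel : measurable_fun setT mulBorel.
Proof. by have [cmul _ _ _ sG] := lcG; exact: (continuous2_Borel _ sG cmul). Qed.

Let smUV : {measure set (Borel G * Borel G) -> \bar R} := (smU \x smV)%E.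

(** The product measure lives on all of [G * G], with [mU] and [mV] carried by [U] and [V]; pushing
    it forward by the full multiplication therefore amounts to pushing forward by psi. *)
Definition product_haar : {measure set (Borel G) -> \bar R}.
Proof. by refine (pushforward smUV mulBorel); exact: measurable_mulBorel. Defined.

Let mpre (A : set (Borel G)) : measurable A -> measurable (mulBorel @^-1` A).
Proof. by move=> mA; rewrite -[X in measurable X]setTI; exact: measurable_mulBorel. Qed.

Lemma product_haarE (A : set (Borel G)) : measurable A ->
  product_haar A = (\int[mU]_u \int[mV]_v (\1_A (gmul u v) : R)%:E)%E.
Proof.
move=> mA; rewrite /product_haar/= /pushforward.
transitivity (\int[smU \x smV]_z (\1_(mulBorel @^-1` A) z)%:E)%E.
  by rewrite integral_indic ?setIT//; exact: mpre.
by rewrite indic_fubini_tonelli1//; exact: mpre.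
Qed.

Lemma measurable_inner_haar (A : set (Borel G)) : measurable A ->
  measurable_fun setT (fun u : Borel G => \int[mV]_v (\1_A (gmul u v) : R)%:E)%E.
Proof.
move=> mA; exact: (indic_measurable_fun_fubini_tonelli_F smV (mpre A mA)).
Qed.

Lemma measurable_indic_mul (A : set (Borel G)) (u : G) : measurable A ->
  measurable_fun setT (fun v : Borel G => (\1_A (gmul u v) : R)%:E).
Proof.
move=> mA; apply/measurable_EFinP.
pose f (uv : Borel G * Borel G) : R := \1_A (mulBorel uv).
apply: (measurable_fun_pair2 (f := f) u).
exact: measurableT_comp (measurable_indic mA) measurable_mulBorel.
Qed.

Let decomp g : exists u v, [/\ U u, V v & g = gmul u v].
Proof.
have [_ [pr [q [_ _ pq]]]] := psi_homeo; have [Up Vq pqg] := pq g.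
by exists (pr g), (q g).
Qed.

Let indic_translate (g : G) (A : set (Borel G)) x :
  (\1_[set gmul g a | a in A] x : R) = \1_A (gmul (ginv g) x).
Proof.
rewrite !indicE; congr (_%:R); congr nat_of_bool.
apply/idP/idP => [/set_mem[a Aa <-]|/set_mem Agx]; apply/mem_set.
  by rewrite gmulA gmulVl gmul1l.
by exists (gmul (ginv g) x) => //; rewrite gmulA gmulVr gmul1l.
Qed.

Lemma measurable_translate (g : G) (A : set (Borel G)) : measurable A ->
  measurable ([set gmul g a | a in A] : set (Borel G)).
Proof.
move=> mA.
have -> : [set gmul g a | a in A] = (fun x => mulBorel (ginv g, x)) @^-1` A.
  apply/seteqP; split=> [_ [a Aa <-]|x Ax]; rewrite /preimage/mulBorel/=.
    by rewrite gmulA gmulVl gmul1l.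
  by exists (gmul (ginv g) x) => //; rewrite gmulA gmulVr gmul1l.
rewrite -[X in measurable X]setTI.
by apply: (measurable_fun_pair2 (f := mulBorel) (ginv g) measurable_mulBorel).
Qed.

(** Write [g = u0 v0]. Translation by [u0] is absorbed by the outer integral, and translation by
    [v0] by the inner one after conjugation into [V]. *)
Lemma product_haar_translate (g : G) (A : set (Borel G)) : measurable A ->
  product_haar [set gmul g a | a in A] = product_haar A.
Proof.
have [u0 [v0 [Uu0 Vv0 ->]]] := decomp g.
have Uinv (u : G) (A' : set (Borel G)) : U u -> measurable A' ->
    product_haar [set gmul u a | a in A'] = product_haar A'.
  move=> Uu mA'.
  rewrite (product_haarE _ mA') (product_haarE _ (measurable_translate u _ mA')).
  have ge0 (x : Borel G) : (0 <= \int[mV]_v (\1_A' (gmul x v) : R)%:E)%E.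
    by apply: integral_ge0 => y _; rewrite lee_fin.
  rewrite -(haar_translate _ _ U mU (ginv u) _ lcG haarU (subgroup_inv _ sgU _ Uu)
    (measurable_inner_haar _ mA') ge0).
  apply: eq_integral => w _; apply: eq_integral => v _.
  by rewrite indic_translate gmulA.
have Vinv (v : G) (A' : set (Borel G)) : V v -> measurable A' ->
    product_haar [set gmul v a | a in A'] = product_haar A'.
  move=> Vv mA'.
  rewrite (product_haarE _ mA') (product_haarE _ (measurable_translate v _ mA')).
  apply: eq_integral => u _.
  (* [w] is determined by [v^-1 u = u w], which turns a translation to the left of [u] into one of
     the variable of [mV]. *)
  pose w := gmul (gmul (ginv u) (ginv v)) u.
  have Vw : V w.
    have := nV (ginv u) _ (subgroup_inv _ sgV _ Vv).
    by rewrite ginvK.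
  rewrite -[RHS](haar_translate _ _ V mV w) //.
  - apply: eq_integral => y _; rewrite indic_translate /w; congr (\1__ _)%:E.
    by rewrite !gmulA gmulVr gmul1l.
  - exact: measurable_indic_mul.
move=> mA.
have -> : [set gmul (gmul u0 v0) a | a in A] =
    [set gmul u0 b | b in [set gmul v0 a | a in A]].
  apply/seteqP; split=> [_ [a Aa <-]|_ [_ [a Aa <-] <-]].
    by exists (gmul v0 a); [exists a|rewrite gmulA].
  by exists a => //; rewrite gmulA.
by rewrite Uinv ?Vinv//; exact: measurable_translate.
Qed.

(** The complement of [U * V], a null set off which multiplication is the injective map psi. *)
Let N : set (Borel G * Borel G) := ((~` U) `*` setT) `|` (setT `*` (~` V)).

Let mN : measurable N.
Proof.
have [clU _ _] := sgU; have [clV _ _] := sgV.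
by apply: measurableU; apply: measurableX => //; apply: measurableC; exact: closed_Borel.
Qed.

Let N0 : smUV N = 0%E.
Proof.
have [clU _ _] := sgU; have [clV _ _] := sgV.
have [U0 _ _ _] := haarU; have [V0 _ _ _] := haarV.
have mCU : measurable (~` U : set (Borel G)) by apply: measurableC; exact: closed_Borel.
have mCV : measurable (~` V : set (Borel G)) by apply: measurableC; exact: closed_Borel.
apply/eqP; rewrite eq_le measure_ge0 andbT.
have N1 : smUV (~` U `*` setT) = 0%E.
  apply: (etrans (product_measure1E smU smV mCU measurableT)).
  by rewrite [X in (X * _)%E](_ : _ = 0%E) ?mul0e.
have N2 : smUV (setT `*` ~` V) = 0%E.
  apply: (etrans (product_measure1E smU smV measurableT mCV)).
  by rewrite [X in (_ * X)%E](_ : _ = 0%E) ?mule0.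
apply: (@le_trans _ _ (smUV (~` U `*` setT) + smUV (setT `*` ~` V))%E).
  by apply: measureU2; exact: measurableX.
by rewrite N1 N2 adde0.
Qed.

(** Up to [N], the preimage of a compact set lies in the product of its two compact coordinate
    images, of finite measure. The preimage of a nonempty open set contains an open box meeting
    [U * V], of positive measure. *)
Lemma left_haar_product_haar : left_haar setT product_haar.
Proof.
have [cmul _ _ _ _] := lcG; have [inj [pr [q [cp cq pq]]]] := psi_homeo.
have [_ _ Ufin Upos] := haarU; have [_ _ Vfin Vpos] := haarV.
split.
- by rewrite setCT measure0.
- by move=> g A _; exact: product_haar_translate.
- move=> K cK _.
  have cpK : compact [set pr g | g in K].
    by apply: continuous_compact => //; exact: continuous_subspaceT.
  have cqK : compact [set q g | g in K].
    by apply: continuous_compact => //; exact: continuous_subspaceT.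
  have mpK := compact_Borel _ hG cpK; have mqK := compact_Borel _ hG cqK.
  have sub : mulBorel @^-1` K `<=` ([set pr g | g in K] `*` [set q g | g in K]) `|` N.
    move=> [u v] Kuv; have [Uu|nUu] := pselect (U u); last by right; left.
    have [Vv|nVv] := pselect (V v); last by right; right.
    have [Up Vq pqg] := pq (gmul u v).
    have [pu qv] := inj _ _ _ _ Up Uu Vq Vv pqg.
    by left; split => /=; exists (gmul u v).
  apply: (@le_lt_trans _ _ (smUV
      (([set pr g | g in K] `*` [set q g | g in K]) `|` N))).
    rewrite /product_haar/= /pushforward le_measure ?inE//.
    - by apply: mpre; exact: compact_Borel.
    - by apply: measurableU => //; exact: measurableX.
  apply: (@le_lt_trans _ _ (smUV ([set pr g | g in K] `*` [set q g | g in K]) +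
      smUV N)%E).
    by apply: measureU2 => //; exact: measurableX.
  rewrite N0 adde0 (_ : smUV _ = smU [set pr g | g in K] * smV [set q g | g in K])%E;
    last exact: product_measure1E.
  apply: lte_mul_pinfty => //.
  + rewrite ge0_fin_numE//; apply: Ufin => // _ [g _ <-].
    by have [] := pq g.
  + apply: Vfin => // _ [g _ <-].
    by have [] := pq g.
- move=> W oW; rewrite setIT => -[g Wg].
  have [u [v [Uu Vv guv]]] := decomp g.
  have : nbhs (u, v) ((fun x : G * G => gmul x.1 x.2) @^-1` W).
    by apply: cmul; apply: open_nbhs_nbhs; split => //=; rewrite -guv.
  move=> [[A B] /= [+ +] AB]; rewrite !nbhsE => -[A' [oA' A'u] A'A] [B' [oB' B'v] B'B].
  have mA' := open_Borel _ oA'; have mB' := open_Borel _ oB'.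
  have sub : A' `*` B' `<=` mulBorel @^-1` W.
    by move=> [x y] [/= A'x B'y]; apply: AB; split; [exact: A'A|exact: B'B].
  apply: (@lt_le_trans _ _ (smUV (A' `*` B'))); last first.
    rewrite /product_haar/= /pushforward le_measure ?inE//.
    - exact: measurableX.
    - by apply: mpre; exact: open_Borel.
  rewrite (_ : smUV _ = smU A' * smV B')%E; last exact: product_measure1E.
  apply: mule_gt0.
  + apply: (@lt_le_trans _ _ (mU (A' `&` U))); first by apply: Upos => //; exists u.
    rewrite le_measure ?inE//; apply: measurableI => //.
    by have [clU _ _] := sgU; exact: closed_Borel.
  + apply: (@lt_le_trans _ _ (mV (B' `&` V))); first by apply: Vpos => //; exists v.
    rewrite le_measure ?inE//; apply: measurableI => //.
    by have [clV _ _] := sgV; exact: closed_Borel.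
Qed.

Section compact_product.
Variables A B : set G.
Hypothesis cA : compact A.
Hypothesis AU : A `<=` U.
Hypothesis Afin : (mU A < +oo)%E.
Hypothesis cB : compact B.
Hypothesis BV : B `<=` V.
Hypothesis Bfin : (mV B < +oo)%E.

Let Q : set (Borel G) := [set gmul uv.1 uv.2 | uv in A `*` B].

Let mA : measurable (A : set (Borel G)). Proof. exact: compact_Borel. Qed.
Let mB : measurable (B : set (Borel G)). Proof. exact: compact_Borel. Qed.

Let preQ : mulBorel @^-1` Q `\` N = A `*` B.
Proof.
have [inj _] := psi_homeo.
apply/seteqP; split=> [[u v] [[[a b] [/= Aa Bb] abuv] nN]|[a b] [/= Aa Bb]].
  have Uu : U u by apply: contrapT => nUu; apply: nN; left.
  have Vv : V v by apply: contrapT => nVv; apply: nN; right.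
  by have [<- <-] := inj _ _ _ _ (AU _ Aa) Uu (BV _ Bb) Vv abuv.
split; first by exists (a, b).
by move=> [[/(_ (AU _ Aa))]|[_ /(_ (BV _ Bb))]].
Qed.

(** Under the continuous coordinates of psi^-1, [Q] is the intersection of the preimages of [A] and
    [B]. *)
Lemma measurable_compact_product : measurable Q.
Proof.
have [inj [pr [q [cp cq pq]]]] := psi_homeo.
have -> : Q = (pr : Borel G -> Borel G) @^-1` A `&` (q : Borel G -> Borel G) @^-1` B.
  apply/seteqP; split=> [_ [[a b] [/= Aa Bb] <-]|g [/= Apg Bqg]].
    have [Up Vq pqg] := pq (gmul a b).
    by have [pa qb] := inj _ _ _ _ Up (AU _ Aa) Vq (BV _ Bb) pqg; rewrite /preimage/= pa qb.
  by exists (pr g, q g) => //=; have [] := pq g.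
by apply: measurableI; rewrite -[X in measurable X]setTI; apply: continuous_Borel.
Qed.

Lemma product_haar_compact_product : product_haar Q = (mU A * mV B)%E.
Proof.
have mpQ : measurable (mulBorel @^-1` Q) by apply: mpre; exact: measurable_compact_product.
have AB : smUV (A `*` B) = (mU A * mV B)%E by exact: product_measure1E.
have mD : measurable (mulBorel @^-1` Q `\` N) by exact: measurableD.
rewrite -AB -preQ; apply/eqP; rewrite eq_le; apply/andP; split.
  apply: (@le_trans _ _ (smUV (mulBorel @^-1` Q `\` N) + smUV N)%E); last by rewrite N0 adde0.
  apply: (@le_trans _ _ (smUV ((mulBorel @^-1` Q `\` N) `|` N))).
    apply: (le_measure smUV); rewrite ?inE//; first exact: measurableU.
    by move=> x Qx; have [Nx|nNx] := pselect (N x); [right|left].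
  exact: measureU2.
by apply: (le_measure smUV); rewrite ?inE// => x [].
Qed.

(** Change of variables to [G * G], removal of the null set [N], which leaves [A * B], then
    Fubini. *)
Lemma Rintegral_compact_product (phi : Borel G -> R) : measurable_fun setT phi ->
  smUV.-integrable (mulBorel @^-1` Q) (fun uv => (phi (mulBorel uv))%:E) ->
  Rintegral product_haar Q phi =
  Rintegral mU A (fun u => Rintegral mV B (fun v => phi (gmul u v))).
Proof.
move=> mphi iphi; have mQ := measurable_compact_product; have mpQ := mpre _ mQ.
have mAB : measurable (A `*` B : set (Borel G * Borel G)) by exact: measurableX.
pose psi (uv : Borel G * Borel G) : \bar R := (phi (mulBorel uv))%:E.
have ipsi : smUV.-integrable (A `*` B) psi.
  by rewrite -preQ; apply: integrableS iphi => //; exact: measurableD.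
pose psiAB : Borel G * Borel G -> \bar R := psi \_ (A `*` B).
have ipsiAB : smUV.-integrable setT psiAB by exact/(integrable_mkcond _ mAB).1.
pose I (u : Borel G) : \bar R := (\int[mV]_(v in B) psi (u, v))%E.
have FE u : A u -> fubini_F smV psiAB u = I u.
  move=> Au; rewrite /fubini_F /I [RHS]integral_mkcond; apply: eq_integral => v _.
  by rewrite /psiAB /patch in_setX/= mem_set.
have FE0 u : ~ A u -> fubini_F smV psiAB u = 0%E.
  move=> nAu; rewrite /fubini_F integral0_eq// => v _.
  by rewrite /psiAB /patch in_setX/= memNset.
have iF := integrable_fubini_F ipsiAB.
rewrite /Rintegral; congr fine.
transitivity (\int[smU]_(u in A) I u)%E.
  transitivity (\int[smUV]_(uv in mulBorel @^-1` Q) psi uv)%E.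
    apply: (integral_pushforward measurable_mulBorel _ iphi mQ).
    exact/measurable_EFinP.
  rewrite (negligible_integral mN mpQ iphi N0) preQ integral_mkcond.
  rewrite -(integral12_prod_meas1 ipsiAB) [RHS]integral_mkcond.
  apply: eq_integral => u _; rewrite /patch; case: ifPn => [/set_mem Au|].
    exact: FE.
  by rewrite notin_setE => nAu; exact: FE0.
have mI : measurable_fun (A : set (Borel G)) I.
  apply: (eq_measurable_fun (fubini_F smV psiAB)) => [u /set_mem Au|]; first by rewrite FE.
  apply: measurable_funTS; exact: measurable_int iF.
(* The inner real-valued integral applies [fine] to [I u], which is finite for almost every [u]. *)
apply: ae_eq_integral => //.
  apply/measurable_EFinP.
  exact: (measurableT_comp (f := fine)) mI.
have := integrable_ae measurableT iF; apply: filterS => u /(_ Logic.I) fu Au.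
have Iu : I u \is a fin_num by rewrite -FE.
exact: (esym (fineK Iu)).
Qed.

End compact_product.

Let smUV_sigma_finite : sigma_finite setT smUV.
Proof.
have /sigma_finiteP[A [TA ndA Afin]] := sigma_finiteT smU.
have /sigma_finiteP[B [TB ndB Bfin]] := sigma_finiteT smV.
exists (fun n => A n `*` B n) => [|n].
  apply/seteqP; split=> // -[x y] _.
  have [i _ Aix] : (\bigcup_i A i) x by rewrite -TA.
  have [j _ Bjy] : (\bigcup_i B i) y by rewrite -TB.
  exists (maxn i j) => //; split => /=.
    by move/subsetPset: (ndA _ _ (leq_maxl i j)); exact.
  by move/subsetPset: (ndB _ _ (leq_maxr i j)); exact.
have [mAn An] := Afin n; have [mBn Bn] := Bfin n.
split; first exact: measurableX.
rewrite (_ : smUV _ = smU (A n) * smV (B n))%E; last exact: product_measure1E.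
by rewrite lte_mul_pinfty// ge0_fin_numE.
Qed.

Lemma haar_avg_product (A B : set G) d (X : measurableType d) (m : probability X R)
    (act : G -> X -> X) (f : X -> R) :
  compact A -> A `<=` U -> (mU A < +oo)%E -> compact B -> B `<=` V -> (mV B < +oo)%E ->
  mp_action setT m act -> m.-integrable setT (EFin \o f) ->
  {ae m, forall x, haar_avg product_haar [set gmul uv.1 uv.2 | uv in A `*` B] act f x =
    (fine (mU A) * fine (mV B))^-1 *
    Rintegral mU A (fun u => Rintegral mV B (fun v => f (act (ginv (gmul u v)) x)))}.
Proof.
move=> cA AU Afin cB BV Bfin actT if_.
have sgT : closed_subgroup [set: G] by split => //; exact: closedT.
have mf : measurable_fun setT f by exact/measurable_EFinP/(measurable_int _ if_).
pose sUV : {sigma_finite_measure set (Borel G * Borel G)%type -> \bar R} :=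
  sigma_finite_measure_of smUV smUV_sigma_finite.
(* The action is indexed by pairs [(u, v)], so that orbit integrability over the preimage of [Q]
   holds for almost every [x], as Fubini requires. *)
pose th (z : ((Borel G * Borel G) * X)%type) : X := orbit_map setT act (mulBorel z.1, z.2).
have mth : measurable_fun setT th.
  apply: (measurableT_comp (measurable_orbit_map setT lcG sgT m act actT)).
  apply: measurable_fun_pair => //.
  exact: measurableT_comp measurable_mulBorel measurable_fst.
have pth uv W : measurable W -> m ((fun x => th (uv, x)) @^-1` W) = m W.
  exact: (orbit_map_preserves setT sgT m act actT (mulBorel uv) W).
have mQ := measurable_compact_product A B cA AU cB BV.
have Qfin : (product_haar [set gmul uv.1 uv.2 | uv in A `*` B] < +oo)%E.
  rewrite product_haar_compact_product//.
  by apply: lte_mul_pinfty => //; rewrite ge0_fin_numE.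
have := ae_orbit_integrable sUV m th mth pth f _ if_ (mpre _ mQ) Qfin.
have orbE g x : orbit_map setT act (g, x) = act (ginv g) x.
  by rewrite /orbit_map/= mem_set.
apply: filterS => x ix; rewrite /haar_avg product_haar_compact_product// fineM; last 2 first.
- by rewrite ge0_fin_numE.
- by rewrite ge0_fin_numE.
congr (_ * _).
have := Rintegral_compact_product A B cA AU cB BV
  (fun g => f (orbit_map setT act (g, x)))
  (measurable_orbit_fun setT lcG sgT m act actT f x mf) ix.
rewrite (_ : (fun g => f (orbit_map setT act (g, x))) = (fun g => f (act (ginv g) x))).
  by move=> ->; congr Rintegral; apply/funext => u; congr Rintegral;
    apply/funext => v; rewrite orbE.
by apply/funext => g; rewrite orbE.
Qed.

End product_haar.

Theorem theorem7p8 (R : realType) (G : topGroupType) (U V : set G)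
    (mU mV : {measure set (Borel G) -> \bar R}) (E F : R -> set G)
    (dX : measure_display) (X : measurableType dX) (m : probability X R)
    (act : G -> X -> X) :
  lcsc_group G ->
  closed_subgroup U -> closed_subgroup V -> normal_subgroup V ->
  left_haar U mU -> left_haar V mV -> amenable V mV ->
  product_homeomorphism U V ->
  (forall T, [/\ compact (E T), E T `<=` U, (0 < mU (E T))%E & (mU (E T) < +oo)%E]) ->
  (forall S, [/\ compact (F S), F S `<=` V, (0 < mV (F S))%E & (mV (F S) < +oo)%E]) ->
  folner V mV F ->
  good_family U mU E -> good_family V mV F ->
  ergodic_action m act ->
  forall (p : R), 1 < p -> forall f : X -> R, Lp_fun m p f ->
  let avg := fun T S (x : X) =>
    (fine (mU (E T)) * fine (mV (F S)))^-1 *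
    Rintegral mU (E T) (fun u : G =>
      Rintegral mV (F S) (fun v : G => f (act (ginv (gmul u v)) x))) in
  [/\ {ae m, forall x, lim_min_inf (fun T S => avg T S x) (Rintegral m setT f)},
      lim_min_inf0e (fun T S =>
        Lnorm m p%:E (fun x => (avg T S x - Rintegral m setT f)%:E)) &
      exists mG : {measure set (Borel G) -> \bar R},
        [/\ forall A : set (Borel G), measurable A ->
              mG A = (\int[mU]_u \int[mV]_v (\1_A (gmul u v) : R)%:E)%E,
            left_haar setT mG &
            forall T S,
              {ae m, forall x, avg T S x =
                 haar_avg mG [set gmul uv.1 uv.2 | uv in E T `*` F S] act f x}]].
Proof.
move=> lcG sgU sgV nV haarU haarV _ homeo hE hF _ goodE goodF erg p p1 f Lf avg.
have decomp g : exists u v, [/\ U u, V v & g = gmul u v].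
  have [_ [pr [q [_ _ pq]]]] := homeo; have [Up Vq pqg] := pq g.
  by exists (pr g), (q g).
have [cvg_ae cvg_Lp] := product_avg_cvg U V mU mV E F lcG sgU sgV nV haarU haarV
  decomp hE hF goodE goodF m act erg p f p1 Lf.
split => //.
exists (product_haar U V mU mV lcG sgU sgV haarU haarV); split.
- by move=> A mA; exact: product_haarE.
- exact: left_haar_product_haar.
- move=> T S; have [cE EU _ Efin] := hE T; have [cF FV _ Ffin] := hF S.
  have [actT _] := erg.
  have := haar_avg_product U V mU mV lcG sgU sgV haarU haarV homeo (E T) (F S)
    _ _ m act f cE EU Efin cF FV Ffin actT (Lp_fun_integrable m p p1 f Lf).
  by apply: filterS => x ->.
Qed.
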